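(* Let $(M,g)$ be a smooth compact Riemannian manifold without boundary of dimension $n\ge 2$, and let $1^*=\frac{n}{n-1}$. Let $K(n,1)$, $L(n,1)$ and $B(1)$ be the constants defined in the context. If $u_0\in BV(M)$ with $\|u_0\|_{L^1(M)}=1$ is an extremal function for the optimal Riemannian $L^1$-entropy inequality, i.e. $$\int_M|u_0|\log|u_0|\,dv_g = n\log\left(L(n,1)\|D_gu_0\|_{BV(M)}+B(1)\right),$$ then $u_0$ is an extremal function for the optimal Riemannian $L^1$-Sobolev inequality, i.e. $$\|u_0\|_{L^{1^*}(M)}=K(n,1)\|D_gu_0\|_{BV(M)}+B(1)\|u_0\|_{L^1(M)}.$$
   Context: Euclidean notions. For $u\in L^1(\mathbb{R}^n)$ put $$\|Du\|_{BV(\mathbb{R}^n)}=\sup\left\{\int_{\mathbb{R}^n}u\,\mathrm{div}(\varphi)\,dx:\ \varphi\in C^1_0(\mathbb{R}^n,\mathbb{R}^n),\ |\varphi|\le 1\right\},$$ and let $BV(\mathbb{R}^n)$ be the set of $u\in L^1(\mathbb{R}^n)$ for which this is finite. The constant $K(n,1)$ is the best constant in the Euclidean $L^1$-Sobolev inequality, i.e. $$K(n,1)^{-1}=\inf\{\|Du\|_{BV(\mathbb{R}^n)}: u\in BV(\mathbb{R}^n),\ \|u\|_{L^{1^*}(\mathbb{R}^n)}=1\}.$$ The constant $L(n,1)$ is the best (smallest) constant such that $$\int_{\mathbb{R}^n}|u|\log|u|\,dx\le n\log\left(L(n,1)\|Du\|_{BV(\mathbb{R}^n)}\right)$$ for all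 $u\in BV(\mathbb{R}^n)$ with $\|u\|_{L^1(\mathbb{R}^n)}=1$. It is known (Beckner, Ledoux) that $L(n,1)=K(n,1)$. Throughout, $0\log 0=0$. Riemannian notions. Let $dv_g$ be the Riemannian volume measure. For $u\in L^1(M)$ put $$\|D_gu\|_{BV(M)}=\sup\left\{\int_M u\,\mathrm{div}_g(X)\,dv_g:\ X \text{ a } C^1 \text{ vector field on } M,\ |X|_g(x)\le 1\ \text{for all } x\in M\right\},$$ and let $BV(M)$ be the set of $u\in L^1(M)$ for which this is finite. The constant $B(1)$ is the smallest $B\in\mathbb{R}$ such that $$\|u\|_{L^{1^*}(M)}\le K(n,1)\|D_gu\|_{BV(M)}+B\|u\|_{L^1(M)}\quad\text{for all }u\in BV(M)$$ (such a finite constant exists by a theorem of Druet); the inequality with $B=B(1)$ is the optimal Riemannian $L^1$-Sobolev inequality. The optimal Riemannian $L^1$-entropy inequality is $$\int_M|u|\log|u|\,dv_g\le n\log\left(L(n,1)\|D_gu\|_{BV(M)}+B(1)\right)\quad\text{for all }u\in BV(M)\text{ with }\|u\|_{L^1(M)}=1.$$ An extremal function for one of these inequalities is a nonzero admissible function for which equality holds. *)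

(* Defs.v *)
From HB Require Import structures.
From mathcomp Require Import all_boot all_order all_algebra.
From mathcomp Require Import all_classical all_reals all_analysis.
From mathcomp Require Import measurable_realfun.

Set Implicit Arguments.
Unset Strict Implicit.
Unset Printing Implicit Defensive.

Import Order.TTheory GRing.Theory Num.Theory.
Import numFieldNormedType.Exports.

Local Open Scope classical_set_scope.
Local Open Scope ring_scope.

Notation Borel T := (g_sigma_algebraType (@open T)).

Section lebesgue_measure_Rn.
Variable R : realType.

Definition rVcons n (p : measurableTypeR R * Borel 'rV[R]_n) : Borel 'rV[R]_n.+1 :=
  \row_i oapp (fun j => (p.2 : 'rV[R]_n) 0 j) p.1 (unlift ord0 i).

Definition rVtail n (v : Borel 'rV[R]_n.+1) : Borel 'rV[R]_n :=
  \row_i (v : 'rV[R]_n.+1) 0 (lift ord0 i).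

Lemma rVcons0 n p : (@rVcons n p : 'rV[R]_n.+1) 0 ord0 = p.1.
Proof. by rewrite mxE unlift_none. Qed.

Lemma rVtailK n p : rVtail (@rVcons n p) = p.2.
Proof. by apply/rowP => i; rewrite !mxE liftK. Qed.

Lemma open_measurable_Borel (T : ptopologicalType) (A : set T) :
  open A -> measurable (A : set (Borel T)).
Proof. by move=> oA; exact: sub_sigma_algebra. Qed.

Lemma measurable_rVtail n : measurable_fun setT (@rVtail n).
Proof.
apply: (@measurability _ _ _ (Borel 'rV[R]_n) _ _ (@open 'rV[R]_n)) => //.
move=> _ [B oB <-]; rewrite setTI; apply: open_measurable_Borel.
rewrite openE => v Bv; have /nbhs_ballP[e e0 eB] : nbhs (rVtail v) B.
  exact: open_nbhs_nbhs.
apply/nbhs_ballP; exists e => // w [_ vw]; apply: eB; split => // i j.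
by rewrite !mxE; exact: vw.
Qed.

Lemma measurable_rV_ord0 n :
  measurable_fun setT (fun v : Borel 'rV[R]_n.+1 => (v : 'rV[R]_n.+1) 0 ord0).
Proof.
apply: (measurability _ (RGenOInfty.measurableE R)) => // _ [_ [x ->] <-].
rewrite setTI; apply: open_measurable_Borel.
have /continuousP := @coord_continuous R 1 n.+1 0 ord0.
by apply; exact: interval_open.
Qed.

Lemma measurable_rVcons n : measurable_fun setT (@rVcons n).
Proof.
apply: (@measurability _ _ _ (Borel 'rV[R]_n.+1) _ _ (@open 'rV[R]_n.+1)) => // _ [U oU <-].
rewrite setTI.
pose c (q : 'rV[rat]_n.+1) : 'rV[R]_n.+1 := map_mx ratr q.
pose I := [set k : 'rV[rat]_n.+1 * rat | ball (c k.1) (ratr k.2) `<=` U].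
have UE : U = \bigcup_(k in I) ball (c k.1) (ratr k.2).
  apply/seteqP; split => [v Uv|v [k Ik] /Ik //].
  have /nbhs_ballP[e/= e0 eU] : nbhs v U by exact: open_nbhs_nbhs.
  have [r /andP[r0 re]] : exists r, 0 < (ratr r : R) < e / 2.
    have e20 : 0 < e / 2 by rewrite divr_gt0.
    have [r] := rat_in_itvoo e20.
    by rewrite in_itv/= => ?; exists r.
  have /choice[q hq] : forall j, exists q, `|(v : 'rV[R]_n.+1) 0 j - ratr q| < ratr r.
    move=> j; set y := _ 0 j; have : y - ratr r < y + ratr r by rewrite ltrD2l gtrN.
    move=> /rat_in_itvoo[q]; rewrite in_itv/= => /andP[q1 q2]; exists q.
    by rewrite distrC ltr_distl q1.
  have cv : ball (c (\row_j q j)) (ratr r) v.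
    by split => // i j; rewrite !mxE ord1 /ball/= distrC.
  exists (\row_j q j, r) => //= w cw; apply: eU.
  by rewrite [e]splitr; apply: ball_triangle (ball_sym _) _;
    [exact: (le_ball (ltW re) cv)|exact: (le_ball (ltW re) cw)].
rewrite UE preimage_bigcup bigcup_mkcond; apply: countable_bigcupT_measurable.
  exact: countableP.
move=> [q r]; case: ifPn => // _.
rewrite (_ : _ @^-1` _ =
  ball (c q 0 ord0) (ratr r) `*` ball (rVtail (c q) : 'rV[R]_n) (ratr r)).
  apply: measurableX; first exact: measurable_ball.
  by apply: open_measurable_Borel; exact: ball_open.
apply/seteqP; split => [[x v] [r0 /= xv]|[x v] [/= qx [r0 qv]]].
  split; first by have := xv 0 ord0; rewrite !mxE unlift_none.
  split => // i j; have := xv 0 (lift ord0 j).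
  by rewrite !mxE liftK ord1.
split => // i j; rewrite ord1 [X in ball _ _ X]mxE.
case: unliftP => [k ->|->] //=.
by have := qv 0 k; rewrite !mxE.
Qed.

Section step.
Variables (n : nat) (mu : {sigma_finite_measure set (Borel 'rV[R]_n) -> \bar R}).

Definition lebRn_step : set (Borel 'rV[R]_n.+1) -> \bar R :=
  pushforward (@lebesgue_measure R \x mu)%E (@rVcons n).


Let mpre A : measurable A -> measurable (@rVcons n @^-1` A).
Proof. by move=> mA; rewrite -[X in measurable X]setTI; exact: measurable_rVcons. Qed.

Let step0 : lebRn_step set0 = 0%E.
Proof. by rewrite /lebRn_step /pushforward preimage_set0 measure0. Qed.

Let step_ge0 A : (0 <= lebRn_step A)%E.
Proof. by rewrite /lebRn_step /pushforward; exact: measure_ge0. Qed.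

Let step_sigma_additive : semi_sigma_additive lebRn_step.
Proof.
move=> F mF tF mUF; rewrite /lebRn_step /pushforward preimage_bigcup.
apply: measure_semi_sigma_additive.
- by move=> k; exact: mpre.
- apply/trivIsetP => /= i j _ _ ij; rewrite -preimage_setI.
  by move/trivIsetP : tF => /(_ _ _ _ _ ij) ->//; rewrite preimage_set0.
- by rewrite -preimage_bigcup; exact: mpre.
Qed.

HB.instance Definition _ := isMeasure.Build _ _ _ lebRn_step
  step0 step_ge0 step_sigma_additive.

Let step_sigma_finite : sigma_finite setT lebRn_step.
Proof.
have /sigma_finiteP[F [TF ndF mF]] := sigma_finiteT mu.
have /sigma_finiteP[G [TG ndG mG]] := sigma_finiteT (@lebesgue_measure R).
exists (fun k => (fun v : Borel 'rV[R]_n.+1 => (v : 'rV[R]_n.+1) 0 ord0) @^-1` G k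
   `&` @rVtail n @^-1` F k).
  apply/esym/seteqP; split => // v _.
  have [i _ Fi] : (\bigcup_i F i) (rVtail v) by rewrite -TF.
  have [j _ Gj] : (\bigcup_i G i) ((v : 'rV[R]_n.+1) 0 ord0) by rewrite -TG.
  exists (maxn i j) => //; split => /=.
    by have /subsetPset := ndG _ _ (leq_maxr i j); apply.
  by have /subsetPset := ndF _ _ (leq_maxl i j); apply.
move=> k; split.
  apply: measurableI; rewrite -[X in measurable X]setTI.
    by apply: measurable_rV_ord0 => //; case: (mG k).
  by apply: measurable_rVtail => //; case: (mF k).
rewrite /lebRn_step /pushforward (_ : _ @^-1` _ = G k `*` F k).
  rewrite product_measure1E; [|by case: (mG k)|by case: (mF k)].
  apply: lte_mul_pinfty; [by []| |by case: (mF k)].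
  by rewrite ge0_fin_numE//; case: (mG k).
by apply/seteqP; split => -[x v]; rewrite /= rVcons0 rVtailK.
Qed.

HB.instance Definition _ := @Measure_isSigmaFinite.Build _ _ _ lebRn_step
  step_sigma_finite.

End step.

Fixpoint lebRn n : {sigma_finite_measure set (Borel 'rV[R]_n) -> \bar R} :=
  match n with
  | 0%N => @dirac _ (Borel 'rV[R]_0) (0 : 'rV[R]_0) R
  | n'.+1 => lebRn_step (lebRn n')
  end.

Lemma lebRn_box n (E : 'I_n -> set R) :
  (forall i, measurable (E i)) ->
  let box := [set v : 'rV[R]_n | forall i, E i (v 0 i)] in
  measurable (box : set (Borel 'rV[R]_n)) /\
  lebRn n box = (\prod_(i < n) lebesgue_measure (E i))%E.
Proof.
elim: n E => [|n IH] E mE box.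
  have -> : box = setT by apply/seteqP; split => // v _ [].
  by split => //; rewrite big_ord0 /= diracT.
have [mb be] := IH (fun i => E (lift ord0 i)) (fun i => mE _).
set b := [set v | _] in mb be.
have boxE : box =
    (fun v : Borel 'rV[R]_n.+1 => (v : 'rV[R]_n.+1) 0 ord0) @^-1` E ord0 `&`
    @rVtail n @^-1` b.
  apply/seteqP; split => [v Ev|v [E0 Eb] i].
    by split => [|i] /=; rewrite ?mxE; exact: Ev.
  by case: (unliftP ord0 i) => [j ->|->//]; have := Eb j; rewrite mxE.
split.
  rewrite boxE; apply: measurableI; rewrite -[X in measurable X]setTI.
    by apply: measurable_rV_ord0 => //; exact: mE.
  exact: measurable_rVtail.
rewrite big_ord_recl -be /= /lebRn_step /pushforward -product_measure1E//; last exact: (mE ord0).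
congr (_ _); rewrite boxE.
by apply/seteqP; split => -[x v]; rewrite /= rVcons0 rVtailK.
Qed.

End lebesgue_measure_Rn.

Section calculus_Rn.
Variables (R : realType) (n : nat).
Local Notation V := 'rV[R]_n.

Definition partial (i : 'I_n) (f : V -> R^o) : V -> R :=
  'D_(delta_mx 0 i : V) f.

(* [U] is meant to be open: all conditions are pointwise conditions on the
   germ of [f] at points of [U], so values of [f] away from [U] are irrelevant *)
Fixpoint Ck_on (k : nat) (U : set V) (f : V -> R^o) : Prop :=
  (forall x, U x -> {for x, continuous f}) /\
  if k is k'.+1 then
    forall i : 'I_n, (forall x, U x -> derivable f x (delta_mx 0 i : V)) /\
                     Ck_on k' U (partial i f)
  else True.

Definition smooth_on (U : set V) (f : V -> R^o) := forall k, Ck_on k U f.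

(* compactly supported C^1 fields *)
Definition C10_field (phi : V -> V) :=
  (forall i, Ck_on 1 setT (fun x => phi x 0 i)) /\
  compact (closure [set x | phi x != 0]).

Definition divRn (phi : V -> V) (x : V) : R :=
  \sum_i partial i (fun y => phi y 0 i) x.

(* the norm [`|v|] of the library is the sup norm, hence this definition *)
Definition euclid_norm (v : V) : R := Num.sqrt (\sum_i v 0 i ^+ 2).

End calculus_Rn.

Section functionals.
Context d (T : measurableType d) (R : realType).
Variable mu : {measure set T -> \bar R}.
Local Open Scope ereal_scope.

(* [ln 0 = 0] in the library, so that 0 log 0 = 0 *)
Definition entropy (u : T -> R) : \bar R :=
  \int[mu]_x (`|u x| * ln `|u x|)%:E.

Definition L1norm (u : T -> R) : \bar R := 'N[mu]_1[EFin \o u].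

Definition Lstarnorm (n : nat) (u : T -> R) : \bar R :=
  'N[mu]_((n%:R / (n%:R - 1))%:E)[EFin \o u].

End functionals.

Definition least (R : realType) (S : set R) (x : R) := S x /\ lbound S x.

Section BV_Rn.
Variables (R : realType) (n : nat).
Local Open Scope ereal_scope.

Definition tvRn (u : Borel 'rV[R]_n -> R) : \bar R :=
  ereal_sup [set \int[lebRn R n]_x (u x * divRn phi x)%:E |
    phi in [set phi : 'rV[R]_n -> 'rV[R]_n |
      C10_field phi /\ forall x, (euclid_norm (phi x) <= 1)%R]].

Definition BVRn (u : Borel 'rV[R]_n -> R) :=
  (lebRn R n).-integrable setT (EFin \o u) /\ tvRn u < +oo.

Definition K1 : R :=
  (fine (ereal_inf [set tvRn u |
    u in [set u | BVRn u /\ Lstarnorm (lebRn R n) n u = 1]]))^-1.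

(* [lne] is the logarithm with value -oo on [-oo, 0] *)
Definition is_L1_entropy_constant (L : R) :=
  least [set L : R | forall u, BVRn u -> L1norm (lebRn R n) u = 1 ->
    entropy (lebRn R n) u <= n%:R%:E * lne (L%:E * tvRn u)] L.

End BV_Rn.

Section manifolds.
Variables (R : realType) (n : nat) (M : ptopologicalType).

Record smooth_atlas := SmoothAtlas {
  chart : Type;
  cdom : chart -> set M;
  cmap : chart -> M -> 'rV[R]_n;
  cinv : chart -> 'rV[R]_n -> M;
  cdom_open : forall a, open (cdom a);
  cimg_open : forall a, open (cmap a @` cdom a);
  cmapK : forall a x, cdom a x -> cinv a (cmap a x) = x;
  cmap_continuous : forall a x, cdom a x -> {for x, continuous (cmap a)};
  cinv_continuous : forall a y, (cmap a @` cdom a) y ->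
    {for y, continuous (cinv a)};
  chart_at : M -> chart;
  chart_atP : forall x, cdom (chart_at x) x;
  transition_smooth : forall a b j,
    smooth_on (cmap a @` (cdom a `&` cdom b))
      (fun y => cmap b (cinv a y) 0 j) }.

Variable A : smooth_atlas.

Definition cimg (a : chart A) : set 'rV[R]_n := cmap a @` cdom a.

Definition overlap (a b : chart A) : set 'rV[R]_n :=
  cmap a @` (cdom a `&` cdom b).

Definition transition (a b : chart A) (y : 'rV[R]_n) : 'rV[R]_n :=
  cmap b (cinv a y).

(* [gmx a y] is the matrix of the metric in the chart [a] at the point of
   coordinates [y]. Tangent vectors are row vectors, and ['J f y] acts on them
   on the right: ['d f y v = v *m 'J f y]. *)
Record riemannian_metric := RiemannianMetric {
  gmx : chart A -> 'rV[R]_n -> 'M[R]_n;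
  gmx_smooth : forall a i j, smooth_on (cimg a) (fun y => gmx a y i j);
  gmx_sym : forall a y, cimg a y -> (gmx a y)^T = gmx a y;
  gmx_pos : forall a y, cimg a y -> forall v : 'rV[R]_n, v != 0 ->
    0 < (v *m gmx a y *m v^T) 0 0;
  gmx_transition : forall a b y, overlap a b y ->
    gmx a y = 'J (transition a b) y *m gmx b (transition a b y) *m
              ('J (transition a b) y)^T }.

(* a vector field is given by its components in each chart; only the values
   of [X a] on [cimg a] are relevant *)
Definition C1_vector_field (X : chart A -> 'rV[R]_n -> 'rV[R]_n) :=
  (forall a i, Ck_on 1 (cimg a) (fun y => X a y 0 i)) /\
  (forall a b y, overlap a b y ->
    X b (transition a b y) = X a y *m 'J (transition a b) y).

Variable g : riemannian_metric.

Definition sqrt_det (a : chart A) (y : 'rV[R]_n) : R :=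
  Num.sqrt (\det (gmx g a y)).

(* the norm and the divergence do not depend on the chart used at [x] *)
Definition vnorm (X : chart A -> 'rV[R]_n -> 'rV[R]_n) (x : M) : R :=
  let a := chart_at A x in let y := cmap a x in
  Num.sqrt ((X a y *m gmx g a y *m (X a y)^T) 0 0).

Definition div_g (X : chart A -> 'rV[R]_n -> 'rV[R]_n) (x : M) : R :=
  let a := chart_at A x in let y := cmap a x in
  (sqrt_det a y)^-1 * \sum_i partial i (fun z => sqrt_det a z * X a z 0 i) y.

Local Open Scope ereal_scope.

(* when countably many charts cover [M] (in particular when [M] is compact),
   at most one Borel measure has this property *)
Definition is_riemannian_volume (vol : {measure set (Borel M) -> \bar R}) :=
  forall (a : chart A) (E : set (Borel M)),
    measurable E -> E `<=` (cdom a : set M) ->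
    vol E = \int[lebRn R n]_(y in (cmap a @` E : set (Borel 'rV[R]_n)))
              (sqrt_det a y)%:E.

Variable vol : {measure set (Borel M) -> \bar R}.

Definition tvM (u : Borel M -> R) : \bar R :=
  ereal_sup [set \int[vol]_x (u x * div_g X x)%:E |
    X in [set X | C1_vector_field X /\ forall x, (vnorm X x <= 1)%R]].

Definition BVM (u : Borel M -> R) :=
  vol.-integrable setT (EFin \o u) /\ tvM u < +oo.

Definition is_sobolev_constant (B : R) :=
  least [set B : R | forall u, BVM u ->
    Lstarnorm vol n u <= (K1 R n)%:E * tvM u + B%:E * L1norm vol u] B.

End manifolds.

(* Main.v *)
(** Jensen's inequality gives [Ent u0 <= n log |u0|_{1*}] on [M]. If [u0] is
extremal for the entropy inequality, then
[L |Du0| + B <= |u0|_{1*} <= K |Du0| + B], so that everything follows from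
[K <= L], i.e., from the fact that the Euclidean entropy inequality with
constant [L] implies the Sobolev inequality with the same constant.

To see this, cut [u] into thin layers [v_j] of height [d], each of which is
close to [d] times the indicator of a superlevel set. The coarea inequality
[\sum_j |D v_j| <= |Du|] is obtained by mollifying [u]. For [w_j = |v_j| / d],
which has values in [[0, 1]], the entropy inequality applied to [v_j / |v_j|_1]
reads [L |D w_j| >= m_j^(1-1/n) exp (- e_j / (n m_j))] with [m_j = |w_j|_1] and
[e_j = - \int w_j log w_j]; here [m_j^(1-1/n) >= |w_j|_{1*}], while [e_j] is at
most the measure of the set where [0 < w_j < 1], and these measures have a
bounded sum. Summing over [j] with Minkowski's inequality and letting [d] tend
to 0 yields [|u|_{1*} <= L |Du|]. *)

Require Import Defs.
From mathcomp Require Import all_boot all_order all_algebra.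
From mathcomp Require Import all_classical all_reals all_analysis.
From mathcomp Require Import measurable_realfun ring lra.

Set Implicit Arguments.
Unset Strict Implicit.
Unset Printing Implicit Defensive.

Import Order.TTheory GRing.Theory Num.Theory.
Import numFieldNormedType.Exports.

Local Open Scope classical_set_scope.
Local Open Scope ring_scope.

(** * Lebesgue measure on R^n *)

Section lebRn_theory.
Variable R : realType.
Local Notation mu := (@lebesgue_measure R).

(** For [u = 1_E / |E|] the entropy inequality with constant [L] is exactly the isoperimetric
    inequality [|E|^(1-1/n) <= L Per(E)], and the layers imitate the classical passage from that
    inequality to the Sobolev one. The total variation being a supremum over test fields, finitely
    many C^1 layers take the place of superlevel sets of finite perimeter: a single test field for
    [u], glued from one field per layer, gives the coarea bound. The price is that a layer is only
    close to a multiple of an indicator, and its entropy defect enters divided by the mass [m_j],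
    hence is harmful when [m_j] is small. Layers of mass at most a threshold [c] are therefore not
    estimated through entropy: each costs at most [d c^(1-1/n)], so those filling a height [T] cost
    at most [T c^(1-1/n)]. This dictates the order of the choices: the lowest level [t] and the
    height [T], then [c], then [d]. Fatou's lemma finally lets [t] tend to 0 and [T] to infinity. *)

Lemma measurable_fun_rV d (T : measurableType d) n (f : T -> Borel 'rV[R]_n) :
  (forall i, measurable_fun setT (fun x => (f x : 'rV[R]_n) 0 i)) ->
  measurable_fun setT f.
Proof.
elim: n f => [|n IH] f mf.
  by rewrite (_ : f = cst 0)//; apply/funext => x; apply/rowP => -[].
(* Through [rVcons], whose measurability relates the Borel sets of row vectors to the product
   sigma-algebra, the induction treats the first coordinate and the tail separately. *)
rewrite (_ : f = @rVcons R n \o (fun x => ((f x : 'rV[R]_n.+1) 0 ord0, rVtail (f x)))).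
  apply: measurableT_comp; first exact: measurable_rVcons.
  apply: measurable_fun_pair; first exact: mf.
  apply: IH => i; rewrite (_ : (fun _ => _) = (fun x => (f x : 'rV[R]_n.+1) 0 (lift ord0 i))).
    exact: mf.
  by apply/funext => x; rewrite mxE.
apply/funext => x /=; apply/rowP => i; rewrite mxE.
by case: unliftP => [j ->|->] //=; rewrite mxE.
Qed.

Lemma continuous_measurable_Borel (T : ptopologicalType) (f : T -> R) :
  continuous f -> measurable_fun (setT : set (Borel T)) f.
Proof.
move=> cf; apply: (measurability _ (RGenOInfty.measurableE R)) => // _ [_ [x ->] <-].
rewrite setTI; apply: open_measurable_Borel.
by move/continuousP : cf; apply; exact: interval_open.
Qed.

Lemma measurable_coord n i :
  measurable_fun setT (fun v : Borel 'rV[R]_n => (v : 'rV[R]_n) 0 i).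
Proof. by apply: continuous_measurable_Borel; exact: coord_continuous. Qed.

Lemma measurable_rVB n : measurable_fun setT
  (fun p : Borel 'rV[R]_n * Borel 'rV[R]_n => (p.1 : 'rV[R]_n) - p.2 : Borel 'rV[R]_n).
Proof.
apply: measurable_fun_rV => i; under eq_fun do rewrite !mxE.
by apply: measurable_funB; apply: measurableT_comp (@measurable_coord n i) _.
Qed.

Lemma measurable_rVDr n (a : 'rV[R]_n) : measurable_fun setT
  (fun x : Borel 'rV[R]_n => (x : 'rV[R]_n) + a : Borel 'rV[R]_n).
Proof.
apply: measurable_fun_rV => i; under eq_fun do rewrite mxE.
by apply: measurable_funD => //; exact: measurable_coord.
Qed.

(** The push-forward of Lebesgue measure under a translation agrees with it on half-open intervals,
    and these determine the measure. *)
Lemma ge0_integral_lebesgue_shift (f : R -> \bar R) a : measurable_fun setT f ->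
  (forall x, 0 <= f x)%E -> (\int[mu]_x f (x + a)%R = \int[mu]_x f x)%E.
Proof.
move=> mf f0.
have ms : measurable_fun setT (fun x : measurableTypeR R => x + a : measurableTypeR R).
  exact: measurable_funD.
transitivity (\int[pushforward mu (fun x : measurableTypeR R => (x + a)%R : measurableTypeR R)]_x f x)%E.
  by rewrite ge0_integral_pushforward.
apply: eq_measure_integral => A mA _; apply/esym.
apply: (@lebesgue_measure_unique R (pushforward mu (fun x : measurableTypeR R => (x + a)%R : measurableTypeR R))) => // X [[l r] lr <-].
rewrite /= /pushforward.
rewrite (_ : _ @^-1` _ = `]l - a, r - a]%classic).
  rewrite !lebesgue_measure_itv/= !lte_fin ltrD2r.
  by case: ifPn => // _; congr EFin; lra.
by apply/seteqP; split=> x /=; rewrite !in_itv/= ltrBlDr lerBrDr.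
Qed.

Lemma ge0_integral_lebRnS n (f : Borel 'rV[R]_n.+1 -> \bar R) :
  measurable_fun setT f -> (forall x, 0 <= f x)%E ->
  (\int[lebRn R n.+1]_x f x =
   \int[mu]_s \int[lebRn R n]_v f (rVcons (s, v)))%E.
Proof.
move=> mf f0; rewrite /= /lebRn_step.
rewrite ge0_integral_pushforward//; last exact: measurable_rVcons.
rewrite preimage_setT.
rewrite fubini_tonelli1//.
  by apply: measurableT_comp => //; exact: measurable_rVcons.
by move=> x; exact: f0.
Qed.

(** Induction on the dimension by Tonelli: the outer integral absorbs the first coordinate of [a],
    the induction hypothesis its tail. *)
Lemma ge0_integral_lebRn_shift n (f : Borel 'rV[R]_n -> \bar R) (a : 'rV[R]_n) :
  measurable_fun setT f -> (forall x, 0 <= f x)%E ->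
  (\int[lebRn R n]_x f ((x : 'rV[R]_n) + a)%R = \int[lebRn R n]_x f x)%E.
Proof.
elim: n f a => [|n IH] f a mf f0.
  by congr integral; apply/funext => x; congr f; apply/rowP => -[].
have mfa : measurable_fun setT (fun x : Borel 'rV[R]_n.+1 => f ((x : 'rV[R]_n.+1) + a)).
  exact: measurableT_comp mf (measurable_rVDr a).
rewrite !ge0_integral_lebRnS//.
have mc s : measurable_fun setT (fun v : Borel 'rV[R]_n => f (rVcons (s, v))).
  exact: measurableT_comp mf (measurableT_comp (@measurable_rVcons R n) (measurable_pair1 s)).
transitivity (\int[mu]_s (\int[lebRn R n]_v f (rVcons ((s + a 0 ord0)%R, v))))%E; last first.
  apply: (@ge0_integral_lebesgue_shift (fun s => \int[lebRn R n]_v f (rVcons (s, v)))%E); last first.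
    by move=> x; exact: integral_ge0.
  apply: (@measurable_fun_fubini_tonelli_F _ _ _ _ _ (lebRn R n) (f \o @rVcons R n)) => //.
  by apply: measurableT_comp => //; exact: measurable_rVcons.
  by move=> x; exact: f0.
apply: eq_integral => s _.
rewrite -[RHS](IH (fun v => f (rVcons ((s + a 0 ord0)%R, v))) (rVtail a))//.
apply: eq_integral => v _; congr f; apply/rowP => i; rewrite !mxE.
by case: unliftP => [j ->|->] //=; rewrite !mxE.
Qed.

Lemma integrable_lebRn_shift n (f : Borel 'rV[R]_n -> \bar R) (a : 'rV[R]_n) :
  (lebRn R n).-integrable setT f ->
  (lebRn R n).-integrable setT (fun x : Borel 'rV[R]_n => f ((x : 'rV[R]_n) + a)).
Proof.
move=> /integrableP[mf fi]; apply/integrableP; split.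
  exact: measurableT_comp mf (measurable_rVDr a).
rewrite (@ge0_integral_lebRn_shift _ (fun x => `|f x|)%E)//.
exact: measurableT_comp.
Qed.

Lemma integral_lebRn_shift n (f : Borel 'rV[R]_n -> \bar R) (a : 'rV[R]_n) :
  measurable_fun setT f ->
  (\int[lebRn R n]_x f ((x : 'rV[R]_n) + a)%R = \int[lebRn R n]_x f x)%E.
Proof.
move=> mf; rewrite integralE [RHS]integralE.
have := ge0_integral_lebRn_shift a (measurable_funepos mf) (funepos_ge0 f).
have := ge0_integral_lebRn_shift a (measurable_funeneg mf) (funeneg_ge0 f).
by move=> <- <-; congr (_ - _)%E; apply: eq_integral => x _; rewrite !(funeposE, funenegE).
Qed.

(** For [a > 0] this is an open ball of the sup norm: its volume is that of a box, and its
    intersection with an open set stays open. *)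
Definition cube n (a : R) : set (Borel 'rV[R]_n) := [set v : 'rV[R]_n | forall i, `|v 0 i| < a].

Lemma measurable_cube n a : measurable (@cube n a).
Proof.
have [m _] := @lebRn_box R n (fun=> `]-a, a[%classic) (fun=> measurable_itv _).
rewrite (_ : @cube n a = [set v : 'rV[R]_n | forall i, `]-a, a[%classic (v 0 i)])//.
by apply/seteqP; split => v /= h i; have := h i; rewrite in_itv/= ltr_norml.
Qed.

Lemma lebRn_cube n a : 0 <= a -> lebRn R n (cube a) = ((2 * a) ^+ n)%:E.
Proof.
move=> a0.
have [_ m] := @lebRn_box R n (fun=> `]-a, a[%classic) (fun=> measurable_itv _).
rewrite (_ : @cube n a = [set v : 'rV[R]_n | forall i, `]-a, a[%classic (v 0 i)]).
  rewrite m lebesgue_measure_itv/=.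
  rewrite big_const card_ord -/(_ ^+ n)%E.
  elim: n {m} => //= n ->; rewrite exprS EFinM; congr (_ * _)%E.
  rewrite lte_fin; case: ltP => aa; first by rewrite -EFinB; congr EFin; lra.
  by congr EFin; lra.
by apply/seteqP; split => v /= h i; have := h i; rewrite in_itv/= ltr_norml.
Qed.

End lebRn_theory.
(** * Differentiation and functions with bounded support *)

Section directional_derivatives.
Context {R : realType} {V : normedModType R}.
Implicit Types (f : V -> R^o) (x v : V).

(** Meant for functions defined by cases, such as [pos2] and [softpos]: the remainder estimate is an
    inequality checked case by case, with no gluing of one-sided derivatives. *)
Lemma is_derive_quad f x v (l C : R) :
  (forall h : R, `|h| <= 1 -> `|f (h *: v + x) - f x - h * l| <= C * h ^+ 2) ->
  is_derive x v f l.
Proof.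
move=> H.
have cv : h^-1 *: ((f \o shift x) (h *: v) - f x) @[h --> (0:R)^'] --> (l : R^o).
  apply/cvgrPdist_le => /= e e0.
  have e1 : 0 < e / (`|C| + 1) by rewrite divr_gt0// ltr_wpDl.
  near=> h.
  have h0 : h != 0 by near: h; exact: nbhs_dnbhs_neq.
  have h1 : `|h| <= 1.
    by near: h; apply: dnbhs0_le.
  have he : `|h| <= e / (`|C| + 1).
    by near: h; apply: dnbhs0_le.
  have hn : 0 < `|h| by rewrite normr_gt0.
  rewrite -(ler_pM2l hn) -normrM mulrBr [h * (_ *: _)]mulrA divff// mul1r.
  rewrite -normrN opprB (le_trans (H _ h1))//.
  rewrite -real_normK ?num_real// expr2 mulrCA ler_wpM2l// ?normr_ge0//.
  apply: le_trans (_ : (`|C| + 1) * `|h| <= _).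
    by rewrite ler_wpM2r// (le_trans (ler_norm _))// lerDl.
  by rewrite -ler_pdivlMl ?ltr_wpDl// mulrC.
by apply: DeriveDef; [apply/cvg_ex; exists l|exact/cvg_lim].
Unshelve. all: by end_near. Qed.

Lemma is_derive_line f x v (l : R) (t : R) : is_derive (t *: v + x) v f l ->
  is_derive t (1 : R) (fun s : R => f (s *: v + x)) l.
Proof.
move=> [df dfl].
have E1 h : (h%:A + t) *: v + x = h *: v + (t *: v + x).
  by rewrite [h%:A]mulr1 scalerDl addrA.
have E2 : (fun h : R => h^-1 *: (((fun s : R => f (s *: v + x)) \o shift t) h%:A - f (t *: v + x)))
    = (fun h : R => h^-1 *: ((f \o shift (t *: v + x)) (h *: v) - f (t *: v + x))).
  by apply/funext => h /=; rewrite E1.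
by split; rewrite -?dfl /derivable /derive E2.
Qed.

(** Only a directional derivative of [f] is given, so the chain rule is applied to the restriction
    of [f] to the line through [x] directed by [v], a function of one real variable. *)
Lemma is_derive_scomp f (g : R -> R) x v (l m : R) :
  is_derive x v f l -> is_derive (f x) (1 : R) g m ->
  is_derive x v (fun y => g (f y) : R^o) (m * l).
Proof.
move=> Df Dg.
have Df0 : is_derive (0 : R) (1 : R) (fun s : R => f (s *: v + x)) l.
  by apply: is_derive_line; rewrite scale0r add0r.
have fx0 : f (0 *: v + x) = f x by rewrite scale0r add0r.
have Dg0 : is_derive (f (0 *: v + x)) (1 : R) g m by rewrite fx0.
have dgf : derivable (g \o (fun s : R => f (s *: v + x))) (0 : R) (1 : R).
  apply/derivable1_diffP; apply: differentiable_comp; apply/derivable1_diffP.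
    exact: (@ex_derive _ _ _ _ _ _ _ Df0).
  exact: (@ex_derive _ _ _ _ _ _ _ Dg0).
split; first exact/derivable1P.
have := @derive1_comp R (fun s : R => f (s *: v + x)) g 0 (@ex_derive _ _ _ _ _ _ _ Df0) (@ex_derive _ _ _ _ _ _ _ Dg0).
rewrite !derive1E (@derive_val _ _ _ _ _ _ _ Df0) (@derive_val _ _ _ _ _ _ _ Dg0) => <-.
rewrite /derive.
have E2 : (fun h : R => h^-1 *: (((g \o (fun s : R => f (s *: v + x))) \o shift 0) h%:A - (g \o (fun s : R => f (s *: v + x))) 0))
    = (fun h : R => h^-1 *: (((fun y => g (f y)) \o shift x) (h *: v) - g (f x))).
  by apply/funext => h /=; rewrite addr0 [h%:A]mulr1 scale0r add0r.
by rewrite E2.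
Qed.

End directional_derivatives.

Section pos2.
Variable R : realType.

(** The first integer power of the positive part that is of class C^1; both the mollifier and the
    layers are built from it. *)
Definition pos2 (s : R) : R := Num.max s 0 ^+ 2.

Lemma pos2_quad s h : `|pos2 (h + s) - pos2 s - h * (2 * Num.max s 0)| <= h ^+ 2.
Proof.
rewrite /pos2 ler_norml; case: (leP s 0) => s0; case: (leP (h + s) 0) => h0;
  apply/andP; split; nra.
Qed.

Lemma is_derive_pos2 s : is_derive s (1 : R) pos2 (2 * Num.max s 0).
Proof.
apply: (@is_derive_quad R R^o pos2 s 1 _ 1) => h _.
by rewrite mul1r [_ *: _]mulr1; exact: pos2_quad.
Qed.

Lemma continuous_pos (f : R -> R) : continuous f -> continuous (fun s => Num.max (f s) 0).
Proof.
move=> cf s; apply: (@continuous_max R _ f (cst 0)) => //; first exact: cf.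
exact: cst_continuous.
Qed.

Lemma continuous_pos2 : continuous pos2.
Proof.
have cm := @continuous_pos id (fun x => cvg_id).
have -> : pos2 = (fun s => Num.max s 0 * Num.max s 0) by apply/funext => s; rewrite /pos2 expr2.
by move=> s; apply: cvgM; exact: cm.
Qed.

End pos2.

(** * Functions supported in a box *)

Section bounded_support.
Context {R : realType} {n : nat}.
Local Notation V := 'rV[R]_n.

Lemma coord_le_norm (x : V) i : `|x 0 i| <= `|x|.
Proof.
rewrite [leRHS]/Num.Def.normr /= mx_normrE; apply/bigmax_geP; right => /=.
by exists (0, i).
Qed.

(** A quantitative form of compact support: the radii add up under convolution, and no closure has
    to be handled. *)
Definition supp_in (r : R) (K : V -> R) := forall x, K x != 0 -> forall i, `|x 0 i| <= r.

Lemma supp_in_le r s (K : V -> R) : r <= s -> supp_in r K -> supp_in s K.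
Proof. by move=> rs Kr x /Kr h i; exact: le_trans (h i) rs. Qed.

Lemma supp_in0 r (K : V -> R) (x : V) : supp_in r K -> (exists i, r < `|x 0 i|) -> K x = 0.
Proof.
move=> Kr [i ri]; apply/eqP; apply: contraT => /Kr /(_ i).
by rewrite leNgt ri.
Qed.

Definition cbox r := [set x : V | forall i, `|x 0 i| <= r].

Lemma compact_cbox r : compact (cbox r).
Proof.
rewrite (_ : cbox r = [set v : 'rV[R]_n | forall i, (`[-r, r]%classic : set R) (v ord0 i)]).
  by apply: (@rV_compact _ _ (fun=> `[-r, r]%classic)) => _; exact: segment_compact.
by apply/seteqP; split => v /= h i; have := h i; rewrite in_itv/= ler_norml.
Qed.

Lemma supp_in_compact r (K : V -> R) : supp_in r K -> compact (closure [set x | K x != 0]).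
Proof.
move=> Kr; apply: (subclosed_compact _ (@compact_cbox r)); first exact: closed_closure.
have := @closure_subset _ _ _ (Kr : [set x | K x != 0] `<=` cbox r).
have cb : closed (cbox r) by apply: compact_closed (@compact_cbox r); exact: norm_hausdorff.
by have /closure_id <- := cb.
Qed.

Lemma supp_in_bounded r (K : V -> R) : continuous K -> supp_in r K -> exists C, forall x, `|K x| <= C.
Proof.
move=> cK Kr.
have /compact_bounded[M [_ /(_ (M + 1))]] : compact ((K : V -> R^o) @` cbox r).
  apply: continuous_compact; last exact: compact_cbox.
  by apply: continuous_subspaceT => x; exact: cK.
rewrite ltrDl ltr01 => /(_ isT) h.
exists `|M + 1| => x; have [->|Kx] := eqVneq (K x) 0; first by rewrite normr0.
apply: le_trans (ler_norm _); apply: h.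
by exists x => //; exact: Kr.
Qed.

(** Heine-Cantor on the box, uniformly in a second point that may lie outside it. If neither point
    is in the support both values vanish; otherwise one of the points is in the box. *)
Lemma supp_in_unif r (K : V -> R) : continuous K -> supp_in r K -> forall e, 0 < e ->
  exists2 d, 0 < d & forall x y, `|x - y| < d -> `|K x - K y| < e.
Proof.
move=> cK Kr e e0.
have := (@compact_near_coveringP _ (cbox r)).1 (@compact_cbox r) R (0^'+)
  (fun d x => forall y, `|x - y| < d -> `|K x - K y| < e) _.
move=> /(_ _) [].
  move=> x _.
  have /cvgrPdist_lt /(_ (e / 2)) := cK x.
  rewrite divr_gt0// => /(_ isT) /nbhs_normP[d /= d0 dP].
  exists (ball x (d / 2), [set t : R | t < d / 2]) => /=.
    split; first by apply: nbhsx_ballx; rewrite divr_gt0.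
    by apply: nbhs_right_lt; rewrite divr_gt0.
  move=> [z t] /= [xz td] y zy.
  move: xz; rewrite -ball_normE /= => xz.
  have Kz : `|K x - K z| < e / 2 by apply: dP => /=; rewrite (lt_trans xz)// ltr_pdivrMr// ltr_pMr// ltr1n.
  have Ky : `|K x - K y| < e / 2.
    apply: dP => /=; rewrite (splitr d) (_ : x - y = (x - z) + (z - y)).
      by rewrite (le_lt_trans (ler_normD _ _))// ltrD// (lt_trans zy).
    by rewrite addrA subrK.
  rewrite (splitr e) (_ : K z - K y = - (K x - K z) + (K x - K y)); last by ring.
  by rewrite (le_lt_trans (ler_normD _ _))// normrN ltrD.
move=> d0 /= d00 dP.
have dd : 0 < d0 / 2 by rewrite divr_gt0.
have {}dP : forall x, cbox r x -> forall y, `|x - y| < d0 / 2 -> `|K x - K y| < e.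
  move=> x; apply: dP => //=.
  by rewrite sub0r normrN gtr0_norm// ltr_pdivrMr// ltr_pMr// ltr1n.
exists (d0 / 2) => // x y xy.
have [Kx|Kx] := eqVneq (K x) 0.
  have [Ky|Ky] := eqVneq (K y) 0; first by rewrite Kx Ky subrr normr0.
  by rewrite distrC; apply: dP; rewrite 1?distrC//; exact: Kr.
by apply: dP => //; exact: Kr.
Qed.

Lemma supp_in_integrable r (K : V -> R) : measurable_fun (setT : set (Borel V)) K ->
  (exists C, forall x, `|K x| <= C) -> supp_in r K ->
  (lebRn R n).-integrable setT (EFin \o K).
Proof.
move=> mK [C KC] Kr.
(* The added 1 puts the closed box of radius [r] inside an open cube. *)
pose a := `|r| + 1.
have a0 : 0 <= a by rewrite addr_ge0.
have C0 : 0 <= C by apply: le_trans (KC 0).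
apply: (@le_integrable _ _ _ _ _ measurableT _ (EFin \o (fun x : Borel V => C * \1_(@cube R n a) x))).
- exact/measurable_EFinP.
- move=> x _ /=; rewrite lee_fin normrM (ger0_norm C0) indicE.
  have [->|Kx] := eqVneq (K x) 0; first by rewrite normr0 mulr_ge0.
  rewrite mem_set ?normr1 ?mulr1//= => i.
  by rewrite (le_lt_trans (Kr _ Kx i))// /a (le_lt_trans (ler_norm _))// ltrDl.
- apply/integrableP; split.
    by apply/measurable_EFinP; apply: measurable_funM => //; apply: measurable_indic; exact: measurable_cube.
  rewrite (eq_integral (fun x : Borel V => C%:E * (\1_(@cube R n a) x)%:E)%E); last first.
    by move=> x _ /=; rewrite ger0_norm ?EFinM// mulr_ge0.
  rewrite ge0_integralZl_EFin//; last first.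
    by apply/measurable_EFinP; apply: measurable_indic; exact: measurable_cube.
  rewrite integral_indic//; last exact: measurable_cube.
  rewrite setIT; apply: lte_mul_pinfty; [by rewrite lee_fin|by []|].
  have h : (lebRn R n (cube a) < +oo)%E by rewrite lebRn_cube// ltry.
  exact: h.
Qed.

End bounded_support.
Section C1_functions.
Context {R : realType} {n : nat}.
Local Notation V := 'rV[R]_n.
Local Notation mu := (lebRn R n).
Local Notation e_ i := (delta_mx 0 i : V).

Lemma continuous_mulr (f g : V -> R) : continuous f -> continuous g ->
  continuous (fun x => f x * g x).
Proof. by move=> cf cg x; apply: (@cvgM R V (nbhs x) _ f g); [exact: cf|exact: cg]. Qed.

Lemma continuous_addr (f g : V -> R) : continuous f -> continuous g ->
  continuous (fun x => f x + g x).
Proof. by move=> cf cg x; apply: (@cvgD R R^o V (nbhs x) _ f g); [exact: cf|exact: cg]. Qed.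

Lemma continuous_compr (g : R -> R) (f : V -> R) : continuous g -> continuous f ->
  continuous (fun x => g (f x)).
Proof. by move=> cg cf x; apply: (@continuous_comp V R R f g); [exact: cf|exact: cg]. Qed.

(** The partial derivatives are carried along as explicit functions, so that products, compositions
    and convolutions come with formulas for them. By [C1_with_Ck] and [Ck_C1_with] this matches
    [Ck_on 1 setT]. *)
Definition C1_with (F : V -> R^o) (dF : 'I_n -> V -> R) :=
  continuous F /\
  forall i, continuous (dF i) /\ forall x, is_derive x (e_ i) F (dF i x : R^o).

Lemma C1_with_Ck F dF : C1_with F dF -> Ck_on 1 setT F.
Proof.
move=> [cF dF_]; split=> [x _|i]; first exact: cF.
have [cdF dFx] := dF_ i; split => [x _|].
  exact: (@ex_derive _ _ _ _ _ _ _ (dFx x)).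
split => // x _; rewrite (_ : partial i F = dF i); first exact: cdF.
by apply/funext => y; exact: (@derive_val _ _ _ _ _ _ _ (dFx y)).
Qed.

Lemma C1_with_partial F dF i : C1_with F dF -> partial i F = dF i.
Proof.
move=> [_ /(_ i)[_ dFx]]; apply/funext => y.
exact: (@derive_val _ _ _ _ _ _ _ (dFx y)).
Qed.

Lemma Ck_C1_with F : Ck_on 1 setT F -> C1_with F (fun i => partial i F).
Proof.
move=> [cF dF]; split => [x|i]; first exact: cF.
have [d [c _]] := dF i; split => x; first exact: c.
by apply: derivableP; exact: d.
Qed.

(** The complement of the closed box is open, so [F] vanishes in a neighbourhood of each point
    outside the box. *)
Lemma C1_with_supp r F dF i : C1_with F dF -> supp_in r F -> supp_in r (dF i).
Proof.
move=> [_ /(_ i)[_ dFx]] Fr x dFx0 j; rewrite leNgt; apply/negP => rx.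
move/eqP : dFx0; apply.
rewrite -(@derive_val _ _ _ _ _ _ _ (dFx x)) -[RHS](derive_cst (0 : R^o) x (e_ i)).
apply: near_eq_derive.
have cx : {for x, continuous (fun y : V => `|y 0 j|)}.
  apply: continuous_comp; first exact: coord_continuous.
  exact: norm_continuous.
have : \forall y \near x, r < `|(y : V) 0 j| by exact: (cvgr_gt _ cx).
apply: filterS => y ry; apply: (supp_in0 Fr); by exists j.
Qed.

Lemma C1_withM F dF G dG : C1_with F dF -> C1_with G dG ->
  C1_with (fun x => F x * G x) (fun i x => F x * dG i x + G x * dF i x).
Proof.
move=> [cF dF_] [cG dG_]; split => [|i]; first exact: continuous_mulr.
have [cdF dFx] := dF_ i; have [cdG dGx] := dG_ i; split => [|x].
  by apply: continuous_addr; exact: continuous_mulr.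
exact: (@is_deriveM _ _ F G x (e_ i) (dF i x) (dG i x)).
Qed.

Lemma C1_with_comp F dF (g dg : R -> R) : C1_with F dF -> continuous g ->
  continuous dg -> (forall s, is_derive s (1 : R) g (dg s)) ->
  C1_with (fun x => g (F x)) (fun i x => dg (F x) * dF i x).
Proof.
move=> [cF dF_] cg cdg gd; split => [|i]; first exact: continuous_compr.
have [cdF dFx] := dF_ i; split => [|x].
  by apply: continuous_mulr => //; exact: continuous_compr.
exact: is_derive_scomp.
Qed.

Lemma C1_measurable F dF : C1_with F dF -> measurable_fun (setT : set (Borel V)) F.
Proof. by move=> [cF _]; exact: continuous_measurable_Borel. Qed.

Lemma C1_measurable_partial F dF i : C1_with F dF ->
  measurable_fun (setT : set (Borel V)) (dF i).
Proof. by move=> [_ /(_ i)[cdF _]]; exact: continuous_measurable_Borel. Qed.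

Lemma supp_in_cts_integrable r K : continuous K -> supp_in r K ->
  mu.-integrable setT (EFin \o K).
Proof.
move=> cK Kr; apply: (supp_in_integrable _ _ Kr).
  exact: continuous_measurable_Borel.
exact: supp_in_bounded Kr.
Qed.

(* translation invariance makes [h |-> \int F (y + h e_i) dy] constant *)
Lemma Rintegral_partial0 r F dF i : C1_with F dF -> supp_in r F ->
  \int[mu]_x dF i x = 0.
Proof.
move=> C1F Fr; have [cF /(_ i)[cdF dFx]] := C1F.
have dFr : supp_in r (dF i) := C1_with_supp C1F Fr.
have [C dFC] := supp_in_bounded cdF dFr.
have C0 : 0 <= C by apply: le_trans (dFC 0).
pose f (h : R) (y : Borel V) := F (h *: e_ i + y).
have fE h : f h = F \o (fun y : Borel V => (y : V) + h *: e_ i).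
  by apply/funext => y; rewrite /f /= addrC.
have If : forall h, mu.-integrable setT (EFin \o f h).
  move=> h; rewrite fE.
  exact: (integrable_lebRn_shift (h *: e_ i) (supp_in_cts_integrable cF Fr)).
have df h y : is_derive h (1 : R) (f ^~ y) (dF i (h *: e_ i + y)).
  by apply: (@is_derive_line R V F y (e_ i)); exact: dFx.
(* One unit for the translations by [h] with [|h| <= 1], one for the strict inequality in the open
   cube. *)
pose a := `|r| + 2.
pose G (y : Borel V) := C * \1_(@cube R n a) y.
have mG : measurable_fun setT G.
  by apply: measurable_funM => //; apply: measurable_indic; exact: measurable_cube.
have I0 : (`](-1 : R), 1[%classic : set R) 0 by rewrite /= in_itv/= ltrN10 ltr01.
have H := @cvg_differentiation_under_integral R _ _ mu f setT measurableT 0 (-1) 1 I0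
  (fun h _ => If h) (fun h y _ _ => @ex_derive _ _ _ _ _ _ _ (df h y)) G _ _ _.
have /cvg_lim <- // : h^-1 *: (\int[mu]_y f (h + 0) y - \int[mu]_y f 0 y) @[h --> (0:R)^'] --> \int[mu]_x dF i x.
  rewrite (_ : \int[mu]_x dF i x = \int[mu]_y partial1of2 f 0 y); last first.
    apply: eq_Rintegral => y _; rewrite partial1of2E (@derive_val _ _ _ _ _ _ _ (df 0 y)).
    by rewrite scale0r add0r.
  apply: H.
  - by move=> y; rewrite /G mulr_ge0.
  - apply: (@supp_in_integrable R n a G mG).
      exists C => y; rewrite /G normrM (ger0_norm C0) ler_piMr// indicE.
      by case: (_ \in _); rewrite ?normr1 ?normr0.
    move=> y; rewrite /G indicE; case: (boolP (y \in _)); last by rewrite mulr0 eqxx.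
    by rewrite inE => yc _ j; rewrite ltW.
  - move=> h y; rewrite /= in_itv/= => h1 _.
    rewrite partial1of2E (@derive_val _ _ _ _ _ _ _ (df h y)).
    have [->|dF0] := eqVneq (dF i (h *: e_ i + y)) 0; first by rewrite normr0 mulr_ge0.
    rewrite /G indicE mem_set ?mulr1// => j.
    have := dFr _ dF0 j; rewrite !mxE eqxx/= => rj.
    have hj : `|h * (j == i)%:R| <= 1.
      rewrite normrM; apply: mulr_ile1 => //; first by rewrite ler_norml; move: h1 => /andP[/ltW -> /ltW ->].
      by case: (j == i); rewrite ?normr1 ?normr0.
    rewrite (_ : (y : V) 0 j = (h * (j == i)%:R + (y : V) 0 j) - h * (j == i)%:R); last by ring.
    rewrite (le_lt_trans (ler_normB _ _))// (le_lt_trans (lerD rj hj))//.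
    by rewrite /a; have := ler_norm r; lra.
rewrite (_ : (fun _ => _) = cst 0) ?lim_cst//.
apply/funext => h /=; rewrite addr0.
suff E k : \int[mu]_y f k y = \int[mu]_y F y by rewrite !E subrr scaler0.
rewrite fE /Rintegral; congr fine.
apply: (@integral_lebRn_shift R n (EFin \o F) (k *: e_ i)).
by apply/measurable_EFinP; exact: continuous_measurable_Borel.
Qed.

End C1_functions.
(** * Mollification *)

Section integrable_real.
Context d (T : measurableType d) {R : realType} (m : {measure set T -> \bar R}).
Implicit Types f g : T -> R.
Local Notation Int f := (m.-integrable setT (EFin \o f)).

Lemma integrable_scale f k : Int f -> Int (fun x => k * f x).
Proof. by move=> /(integrableZl measurableT k); exact: eq_integrable. Qed.

Lemma integrable_add f g : Int f -> Int g -> Int (fun x => f x + g x).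
Proof. by move=> If Ig; have := integrableD measurableT If Ig; exact: eq_integrable. Qed.

Lemma integrable_sub f g : Int f -> Int g -> Int (fun x => f x - g x).
Proof. by move=> If Ig; have := integrableB measurableT If Ig; exact: eq_integrable. Qed.

Lemma integrable_mul_bounded f g C : Int f -> measurable_fun setT g ->
  (forall x, `|g x| <= C) -> Int (fun x => f x * g x).
Proof.
move=> If mg gC.
have mf : measurable_fun setT f by apply/measurable_EFinP; case/integrableP: If.
apply: (@le_integrable _ _ _ _ _ measurableT _ (fun x => (C%:E * (`|f x|)%:E)%E)).
- by apply/measurable_EFinP; exact: measurable_funM.
- move=> x _ /=; rewrite lee_fin !normrM normr_id mulrC ler_wpM2r//.
  exact: le_trans (gC x) (ler_norm _).
- by apply: integrableZl => //; exact: (integrable_norm If).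
Qed.

Lemma integrable_sumr (I : Type) (s : seq I) (F : I -> T -> R) : (forall i, Int (F i)) ->
  Int (fun x => \sum_(i <- s) F i x).
Proof.
move=> IF; elim: s => [|i s IH].
  by under eq_fun do rewrite big_nil; exact: integrable0.
by under eq_fun do rewrite big_cons; exact: integrable_add.
Qed.

Lemma Rintegral_sumr (I : Type) (s : seq I) (F : I -> T -> R) : (forall i, Int (F i)) ->
  \int[m]_x (\sum_(i <- s) F i x) = \sum_(i <- s) \int[m]_x F i x.
Proof.
move=> IF; elim: s => [|i s IH].
  by under eq_Rintegral do rewrite big_nil; rewrite big_nil Rintegral_cst// mul0r.
under eq_Rintegral do rewrite big_cons.
by rewrite big_cons RintegralD ?IH//; exact: integrable_sumr.
Qed.

End integrable_real.

Section convolution.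
Context {R : realType} {n : nat}.
Local Notation V := 'rV[R]_n.
Local Notation mu := (lebRn R n).
Local Notation e_ i := (delta_mx 0 i : V).
Implicit Types (f g : Borel V -> R) (K : V -> R).

Definition conv f K (x : V) : R := \int[mu]_y (f y * K (x - (y : V))).

Lemma measurable_convr K (x : V) : measurable_fun (setT : set (Borel V)) K ->
  measurable_fun setT (fun y : Borel V => K (x - (y : V))).
Proof.
move=> mK.
exact: (measurableT_comp mK (measurableT_comp (@measurable_rVB R n) (measurable_pair1 (x : Borel V)))).
Qed.

Lemma integrable_conv f K C (x : V) : mu.-integrable setT (EFin \o f) ->
  measurable_fun (setT : set (Borel V)) K -> (forall z, `|K z| <= C) ->
  mu.-integrable setT (EFin \o (fun y : Borel V => f y * K (x - (y : V)))).
Proof.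
move=> If mK KC; apply: (integrable_mul_bounded (C := C)) => //.
exact: measurable_convr.
Qed.

Lemma measurable_conv_kernel f K : measurable_fun setT f ->
  measurable_fun (setT : set (Borel V)) K ->
  measurable_fun setT (fun p : Borel V * Borel V => f p.2 * K ((p.1 : V) - (p.2 : V))).
Proof.
move=> mf mK; apply: measurable_funM.
  by apply: measurableT_comp.
exact: (measurableT_comp mK (@measurable_rVB R n)).
Qed.

Lemma continuous_conv r f K : mu.-integrable setT (EFin \o f) -> continuous K ->
  supp_in r K -> continuous (conv f K).
Proof.
move=> If cK Kr x; apply/(@cvgrPdist_le _ _ _ (nbhs x) (@nbhs_filter V x)) => /= e e0.
have [C KC] := supp_in_bounded cK Kr.
have mK : measurable_fun (setT : set (Borel V)) K by exact: continuous_measurable_Borel.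
pose N := \int[mu]_y `|f y|.
have N0 : 0 <= N by apply: Rintegral_ge0.
(* The denominator is [N + 1] because [N] may vanish. *)
have e1 : 0 < e / (N + 1) by rewrite divr_gt0// ltr_wpDl.
have [d d0 dK] := supp_in_unif cK Kr e1.
near=> t.
have xt : `|x - t| < d by near: t; exact: cvgr_dist_lt.
have Ix := integrable_conv x If mK KC; have It := integrable_conv t If mK KC.
rewrite /conv -RintegralB//.
apply: le_trans (le_normr_Rintegral _ _) _ => //.
  have := integrableB measurableT Ix It.
  by apply: eq_integrable => // y _ /=; rewrite EFinB.
apply: (@le_trans _ _ (\int[mu]_y (`|f y| * (e / (N + 1))))).
  apply: le_Rintegral => //.
  - have := integrable_norm (mu := mu) (f := fun y : Borel V => f y * K (x - (y : V)) - f y * K (t - (y : V))).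
    apply => //; have := integrableB measurableT Ix It.
    by apply: eq_integrable => // y _ /=; rewrite EFinB.
  - apply: (integrable_mul_bounded (C := `|e / (N + 1)|)) => //.
    exact: (integrable_norm If).
  move=> y _; rewrite -mulrBr normrM ler_wpM2l// ltW// dK//.
  by rewrite opprB addrA subrK.
rewrite RintegralZr//; last exact: (integrable_norm If).
by rewrite -/N mulrCA ler_piMr ?(ltW e0)// ler_pdivrMr ?ltr_wpDl// mul1r lerDl.
Unshelve. all: by end_near. Qed.

(** Differentiation under the integral sign, dominated by [|f|] times a bound of [dK i]: all the
    smoothness comes from [K], and [f] is merely integrable. *)
Lemma conv_C1 r f K dK : mu.-integrable setT (EFin \o f) -> C1_with K dK ->
  supp_in r K -> C1_with (conv f K) (fun i => conv f (dK i)).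
Proof.
move=> If C1K Kr; have [cK dK_] := C1K; split; first exact: continuous_conv Kr.
move=> i; have [cdK dKx] := dK_ i.
have dKr : supp_in r (dK i) := C1_with_supp C1K Kr.
split; first exact: continuous_conv dKr.
move=> x.
have [C KC] := supp_in_bounded cK Kr.
have [D DK] := supp_in_bounded cdK dKr.
have mK : measurable_fun (setT : set (Borel V)) K by exact: continuous_measurable_Borel.
have D0 : 0 <= D by apply: le_trans (DK 0).
pose F (h : R) (y : Borel V) := f y * K (h *: e_ i + x - (y : V)).
have dF h y : is_derive h (1 : R) (F ^~ y) (f y * dK i (h *: e_ i + x - (y : V))).
  have H : is_derive h (1 : R) (fun s : R => K (s *: e_ i + x - (y : V)) : R^o) (dK i (h *: e_ i + x - (y : V))).
    have -> : (fun s : R => K (s *: e_ i + x - (y : V))) = (fun s : R => K (s *: e_ i + (x - (y : V)))).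
      by apply/funext => s; rewrite addrA.
    by apply: (@is_derive_line R V K (x - (y : V)) (e_ i)); rewrite addrA; exact: dKx.
  exact: (@is_deriveZ _ _ _ (fun s : R => K (s *: e_ i + x - (y : V)) : R^o) (f y) h 1).
have I0 : (`](-1 : R), 1[%classic : set R) 0 by rewrite /= in_itv/= ltrN10 ltr01.
pose G (y : Borel V) := D * `|f y|.
have G0 y : 0 <= G y by rewrite /G mulr_ge0.
have IG : mu.-integrable setT (EFin \o G).
  by apply: integrable_scale; exact: (integrable_norm If).
have IF h : mu.-integrable setT (EFin \o F h) by exact: (integrable_conv (h *: e_ i + x) If mK KC).
have bG h y : `|partial1of2 F h y| <= G y.
  rewrite partial1of2E (@derive_val _ _ _ _ _ _ _ (dF h y)) normrM mulrC.
  by rewrite /G ler_wpM2r.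
have H1 := @derivable_under_integral R _ _ mu F setT measurableT 0 (-1) 1 I0
  (fun h _ => IF h) (fun h y _ _ => @ex_derive _ _ _ _ _ _ _ (dF h y)) G G0 IG (fun h y _ _ => bG h y).
have H2 := @differentiation_under_integral R _ _ mu F setT measurableT 0 (-1) 1 I0
  (fun h _ => IF h) (fun h y _ _ => @ex_derive _ _ _ _ _ _ _ (dF h y)) G G0 IG (fun h y _ _ => bG h y).
split; first exact/derivable1P.
have E : \int[mu]_y partial1of2 F 0 y = conv f (dK i) x.
  apply: eq_Rintegral => y _.
  by rewrite partial1of2E (@derive_val _ _ _ _ _ _ _ (dF 0 y)) scale0r add0r.
rewrite -E -H2 derive1E /derive.
have E2 : (fun h : R => h^-1 *: (((fun x' : R => \int[mu]_y F x' y) \o shift 0) h%:A - \int[mu]_y F 0 y))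
    = (fun h : R => h^-1 *: ((conv f K \o shift x) (h *: e_ i) - conv f K x)).
  apply/funext => h /=; rewrite addr0 [h%:A]mulr1; congr (_ *: (_ - _)).
  by rewrite /F /conv scale0r add0r.
by rewrite E2.
Qed.

Lemma conv_supp r s f K : supp_in r f -> supp_in s K -> supp_in (r + s) (conv f K).
Proof.
move=> fr Ks x cx i; rewrite leNgt; apply/negP => rsx; move/eqP : cx; apply.
rewrite /conv (_ : (fun _ => _) = (fun=> 0)) ?Rintegral_cst ?mul0r//.
apply/funext => y; have [fy|ry] := ltP r (`|(y : V) 0 i|).
  by rewrite (supp_in0 fr) ?mul0r//; exists i.
rewrite (supp_in0 Ks) ?mulr0//; exists i; rewrite !mxE.
have := ler_normD (x 0 i - (y : V) 0 i) ((y : V) 0 i); rewrite subrK; lra.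
Qed.

(** Fubini for [g(x) f(y) K(x - y)], which is integrable on the product because [K] is bounded and
    [f], [g] are integrable. It transfers mollification from [u] to the test field. *)
Lemma conv_adj f g K C : mu.-integrable setT (EFin \o f) -> mu.-integrable setT (EFin \o g) ->
  measurable_fun (setT : set (Borel V)) K -> (forall z, `|K z| <= C) ->
  \int[mu]_x (g x * conv f K x) = \int[mu]_y (f y * conv g (fun z => K (- z)) y).
Proof.
move=> If Ig mK KC.
have mf : measurable_fun setT f by apply/measurable_EFinP; case/integrableP: If.
have mg : measurable_fun setT g by apply/measurable_EFinP; case/integrableP: Ig.
have C0 : 0 <= C by apply: le_trans (KC 0).
pose H (p : Borel V * Borel V) := g p.1 * (f p.2 * K ((p.1 : V) - (p.2 : V))).
have mH : measurable_fun setT H.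
  apply: measurable_funM; first exact: measurableT_comp.
  exact: measurable_conv_kernel.
have mNK : measurable_fun (setT : set (Borel V)) (fun z : V => K (- z)).
  rewrite (_ : (fun z : V => K (- z)) = (fun y : V => K (0 - y))).
    exact: measurable_convr.
  by apply/funext => z; rewrite sub0r.
have IH : (mu \x mu)%E.-integrable setT (EFin \o H).
  apply/integrable12ltyP; first exact/measurable_EFinP.
  apply: (@le_lt_trans _ _ (\int[mu]_x ((C * \int[mu]_y `|f y|)%:E * (`|g x|)%:E))%E).
    apply: ge0_le_integral => //.
    - by move=> x _; exact: integral_ge0.
    - by apply: (@measurable_fun_fubini_tonelli_F _ _ _ _ _ mu (fun p => `|(EFin \o H) p|)%E) => //;
        apply/measurable_EFinP; exact: measurableT_comp.
    - by apply/measurable_EFinP; apply: measurable_funM => //; exact: measurableT_comp.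
    move=> x _.
    rewrite EFinM fineK ?integrable_fin_num//; last exact: (integrable_norm If).
    rewrite muleAC -EFinM -ge0_integralZl_EFin//; [|by apply/measurable_EFinP; exact: measurableT_comp|by rewrite mulr_ge0].
    apply: ge0_le_integral => //.
    - apply: (measurableT_comp (@abse_measurable R setT) ).
      by apply/measurable_EFinP; exact: (measurableT_comp mH (measurable_pair1 x)).
    - by apply/measurable_EFinP; apply: measurable_funM => //; exact: measurableT_comp.
    move=> y _; rewrite /H/= -EFinM lee_fin !normrM.
    rewrite [leRHS](_ : _ = `|g x| * (`|f y| * C)); last by ring.
    by rewrite ler_wpM2l// ler_wpM2l.
  rewrite integralZl//; last exact: (integrable_norm Ig).
  have : (\int[mu]_x (`|g x|)%:E)%E \is a fin_num by apply: integrable_fin_num => //; exact: (integrable_norm Ig).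
  by move=> /fineK <-; rewrite -EFinM ltry.
have NKC z : `|K (- z)| <= C by exact: KC.
have E1 x : (g x * conv f K x)%:E = (\int[mu]_y (EFin \o H) (x, y))%E.
  have Ix := integrable_conv x If mK KC.
  have E := RintegralZl (g x) measurableT Ix.
  rewrite [conv f K x]/conv -E /Rintegral fineK//.
  by apply: integrable_fin_num => //; exact: integrable_scale (g x) Ix.
have E2 y : (f y * conv g (fun z => K (- z)) y)%:E = (\int[mu]_x (EFin \o H) (x, y))%E.
  have Iy := integrable_conv y Ig mNK NKC.
  have E := RintegralZl (f y) measurableT Iy.
  rewrite [conv g _ y]/conv -E /Rintegral fineK; last first.
    by apply: integrable_fin_num => //; exact: integrable_scale (f y) Iy.
  by apply: eq_integral => x _; congr EFin; rewrite /H /= opprB; ring.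
rewrite /Rintegral; apply: (congr1 fine).
transitivity (\int[mu]_x \int[mu]_y (EFin \o H) (x, y))%E.
  by apply: eq_integral => x _; exact: E1.
rewrite (Fubini IH).
by apply: eq_integral => y _; exact/esym/E2.
Qed.

End convolution.
Section mollifier.
Context {R : realType} {n : nat}.
Local Notation V := 'rV[R]_n.
Local Notation mu := (lebRn R n).
Local Notation e_ i := (delta_mx 0 i : V).

Definition sqnorm (z : V) : R := \sum_j z 0 j ^+ 2.

Lemma sqnormN z : sqnorm (- z) = sqnorm z.
Proof. by apply: eq_bigr => j _; rewrite mxE sqrrN. Qed.

Lemma coord_sqnorm (z : V) i : z 0 i ^+ 2 <= sqnorm z.
Proof. by rewrite /sqnorm (bigD1 i)//= lerDl sumr_ge0// => j _; exact: sqr_ge0. Qed.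

Lemma continuous_sqnorm : continuous (sqnorm : V -> R).
Proof.
have -> : (sqnorm : V -> R) = (fun z : V => (\sum_(j < n) (fun z : V => z 0 j * z 0 j)) z).
  by apply/funext => z; rewrite fct_sumE; apply: eq_bigr => j _; rewrite expr2.
elim/big_ind : _ => [|f g cf cg|j _].
- exact: cst_continuous.
- exact: continuous_addr.
- by apply: continuous_mulr; exact: coord_continuous.
Qed.

Lemma is_derive_sqnorm (z : V) i : is_derive z (e_ i) (sqnorm : V -> R^o) (2 * z 0 i).
Proof.
apply: (@is_derive_quad R V sqnorm z (e_ i) _ 1) => h _.
rewrite mul1r /sqnorm (bigD1 i)//= [X in _ - X - _](bigD1 i)//= !mxE !eqxx /=.
rewrite (eq_bigr (fun j => z 0 j ^+ 2)); last first.
  by move=> j ji; rewrite !mxE /= (negbTE ji) mulr0 add0r.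
rewrite (_ : _ - _ - _ = h ^+ 2); last by rewrite mulr1; ring.
by rewrite ger0_norm// sqr_ge0.
Qed.

(** Class C^1 is all that is asked of the mollifier. As a function of [sqnorm] it is even, so its
    partial derivatives are odd; this oddness produces the minus sign when a derivative is moved
    across a convolution. *)
Definition bump (r : R) (z : V) : R := pos2 (r ^+ 2 - sqnorm z).

Definition dbump (r : R) (i : 'I_n) (z : V) : R :=
  2 * Num.max (r ^+ 2 - sqnorm z) 0 * (- (2 * z 0 i)).

Lemma bump_C1 r : C1_with (bump r) (dbump r).
Proof.
have C : C1_with (fun z => r ^+ 2 - sqnorm z) (fun i (z : V) => - (2 * z 0 i)).
  split=> [|i].
    apply: (@continuous_addr _ _ (cst (r ^+ 2)) (fun z => - sqnorm z)).
      exact: cst_continuous.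
    apply: (@continuous_compr _ _ -%R); [exact: opp_continuous|exact: continuous_sqnorm].
  split.
    apply: (@continuous_compr _ _ -%R); first exact: opp_continuous.
    apply: (@continuous_mulr _ _ (cst 2)); [exact: cst_continuous|exact: coord_continuous].
  move=> x; rewrite -[- _]add0r.
  exact: (@is_deriveB _ _ _ (cst (r ^+ 2)) (sqnorm : V -> R^o) x (e_ i) 0 (2 * x 0 i) _ (is_derive_sqnorm x i)).
apply: (@C1_with_comp R n _ _ (@pos2 R) (fun s => 2 * Num.max s 0) C).
- exact: continuous_pos2.
- have cm := @continuous_pos R id (fun x => cvg_id).
  by move=> s; apply: (@cvgM _ _ (nbhs s) _ (cst 2) (fun s => Num.max s 0)); [exact: cvg_cst|exact: cm].
- exact: is_derive_pos2.
Qed.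

Lemma bump_ge0 r z : 0 <= bump r z.
Proof. exact: sqr_ge0. Qed.

Lemma bumpN r z : bump r (- z) = bump r z.
Proof. by rewrite /bump sqnormN. Qed.

Lemma dbumpN r i z : dbump r i (- z) = - dbump r i z.
Proof. by rewrite /dbump sqnormN mxE; ring. Qed.

Lemma bump_supp r : 0 <= r -> supp_in r (bump r).
Proof.
move=> r0 z; rewrite /bump /pos2 => bz i.
have : 0 < r ^+ 2 - sqnorm z.
  by rewrite ltNge; apply: contra bz => h; rewrite max_r// expr0n.
rewrite subr_gt0 => zr; rewrite -(ler_pXn2r (_ : (0 < 2)%N)) ?nnegrE//.
by rewrite real_normK ?num_real// (le_trans (coord_sqnorm z i))// ltW.
Qed.

Lemma bump_int_gt0 r : 0 < r -> 0 < \int[mu]_z bump r z.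
Proof.
move=> r0.
(* On the cube of half-side [s] one has [sqnorm z <= n s^2 < r^2], so [bump] is bounded below there
   by a positive constant. Dividing by [n + 1] makes the inequality strict. *)
pose s := r / n.+1%:R.
have s0 : 0 < s by rewrite divr_gt0.
have ns : n%:R * s ^+ 2 < r ^+ 2.
  rewrite /s expr_div_n mulrCA gtr_pMr ?exprn_gt0//.
  rewrite ltr_pdivrMr ?exprn_gt0// mul1r -natrX ltr_nat expnS expn1.
  by rewrite (leq_trans (ltnSn n))// leq_pmulr.
pose m := pos2 (r ^+ 2 - n%:R * s ^+ 2).
have m0 : 0 < m by rewrite /m /pos2 max_l ?exprn_gt0 ?subr_gt0// ltW// subr_gt0.
have Ib := supp_in_cts_integrable (bump_C1 r).1 (bump_supp (ltW r0)).
have Ii : mu.-integrable setT (EFin \o (fun z : Borel V => m * \1_(@cube R n s) z)).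
  apply: (@supp_in_integrable R n s (fun z : Borel V => m * \1_(@cube R n s) z)).
  - by apply: measurable_funM => //; apply: measurable_indic; exact: measurable_cube.
  - exists m => z; rewrite normrM gtr0_norm// ler_piMr ?(ltW m0)// indicE.
    by case: (_ \in _); rewrite ?normr1 ?normr0.
  - move=> y; rewrite indicE; case: (boolP (y \in _)); last by rewrite mulr0 eqxx.
    by rewrite inE => yc _ j; rewrite ltW.
apply: (@lt_le_trans _ _ (\int[mu]_z (m * \1_(@cube R n s) z))); last first.
  apply: le_Rintegral => // z _; rewrite indicE.
  case: (boolP (z \in _)); last by rewrite mulr0 bump_ge0.
  rewrite inE mulr1 => zs.
  have zn : sqnorm z <= n%:R * s ^+ 2.
    rewrite /sqnorm (le_trans (_ : _ <= \sum_(j < n) s ^+ 2))//.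
      apply: ler_sum => j _; rewrite -real_normK ?num_real//.
      by rewrite ler_pXn2r// ?nnegrE ?(ltW s0)// ltW.
    by rewrite sumr_const card_ord mulr_natl.
  have zr := le_trans zn (ltW ns).
  rewrite /m /bump /pos2 !max_l ?subr_ge0 ?(ltW ns)//.
  by rewrite ler_pXn2r ?nnegrE ?subr_ge0 ?(ltW ns)// lerD2l lerN2.
rewrite RintegralZl//; last first.
  apply/integrableP; split; first by apply/measurable_EFinP; apply: measurable_indic; exact: measurable_cube.
  rewrite (eq_integral (EFin \o \1_(@cube R n s))); last by move=> x _ /=; rewrite ger0_norm.
  rewrite integral_indic ?setIT//; last exact: measurable_cube.
  have h : (lebRn R n (cube s) < +oo)%E by rewrite lebRn_cube ?(ltW s0)// ltry.
  exact: h.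
rewrite mulr_gt0// /Rintegral integral_indic ?setIT//; last exact: measurable_cube.
have h : 0 < fine (lebRn R n (cube s)) by rewrite lebRn_cube ?(ltW s0)//= exprn_gt0// mulr_gt0.
exact: h.
Qed.

Definition moll r (z : V) : R := (\int[mu]_z bump r z)^-1 * bump r z.

Definition dmoll r (i : 'I_n) (z : V) : R := (\int[mu]_z bump r z)^-1 * dbump r i z.

Lemma moll_C1 r : C1_with (moll r) (dmoll r).
Proof.
set c := (\int[mu]_z bump r z)^-1.
have [cb db] := bump_C1 r; split => [|i].
  by apply: (@continuous_mulr _ _ (cst c)) => //; exact: cst_continuous.
have [cdb dbx] := db i; split => [|x].
  by apply: (@continuous_mulr _ _ (cst c)) => //; exact: cst_continuous.
exact: (@is_deriveZ _ _ _ (bump r : V -> R^o) c x).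
Qed.

Lemma moll_ge0 r z : 0 < r -> 0 <= moll r z.
Proof. by move=> r0; rewrite mulr_ge0 ?bump_ge0// invr_ge0 ltW// bump_int_gt0. Qed.

Lemma mollN r z : moll r (- z) = moll r z.
Proof. by rewrite /moll bumpN. Qed.

Lemma dmollN r i z : dmoll r i (- z) = - dmoll r i z.
Proof. by rewrite /dmoll dbumpN mulrN. Qed.

Lemma moll_supp r : 0 <= r -> supp_in r (moll r).
Proof.
move=> r0 z h; apply: (bump_supp r0); apply: contra h => /eqP h.
by rewrite /moll h mulr0.
Qed.

Lemma dmoll_supp r i : 0 <= r -> supp_in r (dmoll r i).
Proof. by move=> r0; exact: C1_with_supp (moll_C1 r) (moll_supp r0). Qed.

Lemma moll_int r : 0 < r -> \int[mu]_z moll r z = 1.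
Proof.
move=> r0; rewrite /moll RintegralZl//; last first.
  exact: supp_in_cts_integrable (bump_C1 r).1 (bump_supp (ltW r0)).
by rewrite mulVf// gt_eqF// bump_int_gt0.
Qed.

Lemma moll_bounded r : 0 <= r -> exists C, forall z, `|moll r z| <= C.
Proof. by move=> r0; exact: supp_in_bounded (moll_C1 r).1 (moll_supp r0). Qed.

Lemma dmoll_bounded r i : 0 <= r -> exists C, forall z, `|dmoll r i z| <= C.
Proof.
move=> r0; have [_ /(_ i)[cd _]] := moll_C1 r.
exact: supp_in_bounded cd (@dmoll_supp r i r0).
Qed.

Lemma measurable_moll r : measurable_fun (setT : set (Borel V)) (moll r).
Proof. exact: C1_measurable (moll_C1 r). Qed.

Lemma measurable_dmoll r i : measurable_fun (setT : set (Borel V)) (dmoll r i).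
Proof. exact: C1_measurable_partial (moll_C1 r). Qed.

Lemma integral_moll r : 0 < r -> (\int[mu]_z (moll r z)%:E = 1)%E.
Proof.
move=> r0; rewrite -[LHS]fineK.
  by rewrite -/(Rintegral _ _ _) moll_int.
apply: integrable_fin_num => //.
exact: supp_in_cts_integrable (moll_C1 r).1 (moll_supp (ltW r0)).
Qed.

Lemma integral_mollBl r (y : V) : 0 < r -> (\int[mu]_x (moll r ((x : V) - y))%:E = 1)%E.
Proof.
move=> r0; rewrite -(integral_moll r0).
apply: (@ge0_integral_lebRn_shift R n (fun z => (moll r z)%:E) (- y)).
  by apply/measurable_EFinP; exact: measurable_moll.
by move=> x; rewrite lee_fin moll_ge0.
Qed.

Lemma integral_mollBr r (x : V) : 0 < r -> (\int[mu]_y (moll r (x - (y : V)))%:E = 1)%E.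
Proof.
move=> r0; rewrite -(integral_mollBl x r0); apply: eq_integral => y _.
by rewrite -mollN opprB.
Qed.

End mollifier.

(** * Convergence of mollifications in L^1 *)

Section L1_approximation.
Context {R : realType} {n : nat}.
Local Notation V := 'rV[R]_n.
Local Notation mu := (lebRn R n).
Implicit Types (f g : Borel V -> R).
Local Notation Int f := (mu.-integrable setT (EFin \o f)).

(** Tonelli: integrated in [x] first, the kernel has mass 1 for every [y]. It yields both the L^1
    contraction property and the conservation of mass for indicators. *)
Lemma integral_norm_moll r f : 0 < r -> measurable_fun setT f ->
  (\int[mu]_x \int[mu]_y (`|f y| * moll r ((x : V) - (y : V)))%:E = \int[mu]_y `|f y|%:E)%E.
Proof.
move=> r0 mf.
pose H (p : Borel V * Borel V) := (`|f p.2| * moll r ((p.1 : V) - (p.2 : V)))%:E.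
have mH : measurable_fun setT H.
  apply/measurable_EFinP; apply: (@measurable_conv_kernel R n (fun y => `|f y|)).
    exact: measurableT_comp.
  exact: measurable_moll.
have H0 p : (0 <= H p)%E by rewrite lee_fin mulr_ge0// moll_ge0.
rewrite (@fubini_tonelli _ _ _ _ _ mu mu H mH H0); apply: eq_integral => y _.
rewrite /H /=; under eq_integral do rewrite EFinM.
rewrite ge0_integralZl_EFin//.
- by rewrite integral_mollBl// mule1.
- by move=> x _; rewrite lee_fin moll_ge0.
- apply/measurable_EFinP.
  exact: (measurableT_comp (@measurable_moll R n r) (measurableT_comp (@measurable_rVB R n) (measurable_pair2 y))).
Qed.

Lemma integral_norm_conv_moll r f : 0 < r -> Int f ->
  (\int[mu]_x `|conv f (moll r) x|%:E <= \int[mu]_y `|f y|%:E)%E.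
Proof.
move=> r0 If; have mf : measurable_fun setT f by apply/measurable_EFinP; case/integrableP: If.
have [C KC] := @moll_bounded R n r (ltW r0).
rewrite -(integral_norm_moll r0 mf); apply: ge0_le_integral => //.
- by apply/measurable_EFinP; apply: measurableT_comp => //; apply: C1_measurable;
    exact: conv_C1 If (moll_C1 r) (moll_supp (ltW r0)).
- apply: (@measurable_fun_fubini_tonelli_F _ _ _ _ _ mu (fun p : Borel V * Borel V => (`|f p.2| * moll r ((p.1 : V) - (p.2 : V)))%:E)).
    apply/measurable_EFinP; apply: (@measurable_conv_kernel R n (fun y => `|f y|)).
      exact: measurableT_comp.
    exact: measurable_moll.
  by move=> p; rewrite lee_fin mulr_ge0// moll_ge0.
move=> x _; have Ix := integrable_conv x If (@measurable_moll R n r) KC.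
apply: le_trans (_ : (\int[mu]_y `|f y * moll r (x - (y : V))|)%:E <= _)%E.
  by rewrite lee_fin; exact: le_normr_Rintegral.
rewrite /Rintegral fineK; last first.
  by apply: integrable_fin_num => //; exact: (integrable_norm Ix).
rewrite le_eqVlt; apply/orP; left; apply/eqP; apply: eq_integral => y _.
by rewrite normrM (ger0_norm (moll_ge0 _ r0)).
Qed.

Lemma integrable_conv_moll r f : 0 < r -> Int f -> Int (conv f (moll r)).
Proof.
move=> r0 If; apply/integrableP; split.
  by apply/measurable_EFinP; exact: C1_measurable (conv_C1 If (moll_C1 r) (moll_supp (ltW r0))).
apply: le_lt_trans (integral_norm_conv_moll r0 If) _.
by have /integrableP[] := If.
Qed.

Definition nrm1 f : R := \int[mu]_x `|f x|.

Lemma nrm1_ge0 f : 0 <= nrm1 f. Proof. exact: Rintegral_ge0. Qed.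

Lemma nrm1D f g : Int f -> Int g -> nrm1 (fun x => f x + g x) <= nrm1 f + nrm1 g.
Proof.
move=> If Ig; rewrite /nrm1 -RintegralD//; try exact: integrable_norm.
apply: le_Rintegral => //; first exact: (integrable_norm (integrable_add If Ig)).
  exact: (integrable_add (integrable_norm If) (integrable_norm Ig)).
by move=> x _; exact: ler_normD.
Qed.

Lemma nrm1Z f k : Int f -> nrm1 (fun x => k * f x) = `|k| * nrm1 f.
Proof.
move=> If; rewrite /nrm1 -RintegralZl//; last exact: integrable_norm.
by apply: eq_Rintegral => x _; rewrite normrM.
Qed.

Lemma nrm1_conv r f : 0 < r -> Int f -> nrm1 (conv f (moll r)) <= nrm1 f.
Proof.
move=> r0 If; apply: fine_le; [| |exact: integral_norm_conv_moll];
  apply: integrable_fin_num => //; apply: (@integrable_norm _ _ _ _ _ _) => //.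
exact: integrable_conv_moll.
Qed.

Lemma convD r f g x : 0 < r -> Int f -> Int g ->
  conv (fun y => f y + g y) (moll r) x = conv f (moll r) x + conv g (moll r) x.
Proof.
move=> r0 If Ig; have [C KC] := @moll_bounded R n r (ltW r0).
rewrite /conv -RintegralD//; try exact: integrable_conv (@measurable_moll R n r) KC.
by apply: eq_Rintegral => y _; rewrite mulrDl.
Qed.

Lemma convZ r f k x : 0 < r -> Int f ->
  conv (fun y => k * f y) (moll r) x = k * conv f (moll r) x.
Proof.
move=> r0 If; have [C KC] := @moll_bounded R n r (ltW r0).
rewrite /conv -RintegralZl//; last exact: integrable_conv (@measurable_moll R n r) KC.
by apply: eq_Rintegral => y _; rewrite mulrA.
Qed.

Definition rad (k : nat) : R := k.+1%:R^-1.

Lemma rad_gt0 k : 0 < rad k. Proof. by rewrite invr_gt0. Qed.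

Definition mollify k f : Borel V -> R := conv f (moll (rad k)).

(** The class of functions whose mollifications converge to them in L^1. It is stable under linear
    combinations and L^1 limits, and is extended from indicators of open sets to all integrable
    functions. *)
Definition L1_approx f := Int f /\ forall e, 0 < e ->
  \forall k \near \oo, nrm1 (fun x => mollify k f x - f x) <= e.

Lemma L1_approxD f g : L1_approx f -> L1_approx g -> L1_approx (fun x => f x + g x).
Proof.
move=> [If Hf] [Ig Hg]; split; first exact: integrable_add.
move=> e e0; have e2 : 0 < e / 2 by rewrite divr_gt0.
near=> k.
rewrite (_ : (fun _ => _) = (fun x => (mollify k f x - f x) + (mollify k g x - g x))); last first.
  by apply/funext => x; rewrite /mollify convD ?rad_gt0//; ring.
apply: (le_trans (nrm1D _ _)); try by apply: integrable_sub => //; exact: (integrable_conv_moll (rad_gt0 k)).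
by rewrite (splitr e) lerD//; near: k; [exact: Hf|exact: Hg].
Unshelve. all: by end_near. Qed.

Lemma L1_approxZ f c : L1_approx f -> L1_approx (fun x => c * f x).
Proof.
move=> [If Hf]; split; first exact: integrable_scale.
move=> e e0; have e2 : 0 < e / (`|c| + 1) by rewrite divr_gt0// ltr_wpDl.
near=> k.
rewrite (_ : (fun _ => _) = (fun x => c * (mollify k f x - f x))); last first.
  by apply/funext => x; rewrite /mollify convZ ?rad_gt0//; ring.
rewrite nrm1Z; last by apply: integrable_sub => //; exact: (integrable_conv_moll (rad_gt0 k)).
apply: (@le_trans _ _ ((`|c| + 1) * (e / (`|c| + 1)))); last first.
  by rewrite mulrCA mulfV ?mulr1// gt_eqF// ltr_wpDl.
apply: ler_pM => //; [exact: nrm1_ge0|by rewrite lerDl|].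
by near: k; exact: Hf.
Unshelve. all: by end_near. Qed.

(** Mollification is an L^1 contraction for every [k], so the error splits into three thirds, only
    one of which depends on [k]. *)
Lemma L1_approx_lim f : Int f ->
  (forall e, 0 < e -> exists2 g, L1_approx g & nrm1 (fun x => f x - g x) <= e) ->
  L1_approx f.
Proof.
move=> If H; split => // e e0; have e3 : 0 < e / 3 by rewrite divr_gt0.
have [g [Ig Hg] fg] := H _ e3.
near=> k; have rk := rad_gt0 k.
have Icg := integrable_conv_moll rk Ig.
have Ifg := integrable_sub If Ig.
have Igf : Int (fun x => (-1) * (f x - g x)) by exact: integrable_scale.
have Icfg := integrable_conv_moll rk Ifg.
have Imgg := integrable_sub Icg Ig.
rewrite (_ : (fun _ => _) = (fun x => conv (fun y => f y - g y) (moll (rad k)) x +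
    ((mollify k g x - g x) + (-1) * (f x - g x)))); last first.
  apply/funext => x; rewrite /mollify.
  rewrite {1}(_ : f = (fun y => (f y - g y) + g y)); last by apply/funext => y; rewrite subrK.
  by rewrite convD//; ring.
apply: (le_trans (nrm1D Icfg (integrable_add Imgg Igf))).
rewrite (_ : e = e / 3 + (e / 3 + e / 3)); last by field.
apply: lerD; first exact: le_trans (nrm1_conv rk Ifg) fg.
apply: (le_trans (nrm1D Imgg Igf)); apply: lerD.
  by near: k; exact: Hg.
by rewrite nrm1Z// normrN1 mul1r.
Unshelve. all: by end_near. Qed.

Lemma integrable_indic_fin (A : set (Borel V)) : measurable A -> (mu A < +oo)%E -> Int (\1_A).
Proof.
move=> mA Afin; apply/integrableP; split.
  by apply/measurable_EFinP; exact: measurable_indic.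
rewrite (eq_integral (EFin \o \1_A)); last by move=> x _ /=; rewrite ger0_norm.
by rewrite integral_indic// setIT.
Qed.

(* On [U] the mollified indicator tends to 1 pointwise, and as its integral is
   that of [\1_U], the mass outside [U] vanishes in the limit: no regularity of
   the boundary of [U] is needed. *)
Lemma L1_approx_open (U : set V) : open U -> (mu (U : set (Borel V)) < +oo)%E ->
  L1_approx (\1_(U : set (Borel V))).
Proof.
move=> oU Ufin; have mU : measurable (U : set (Borel V)) by exact: open_measurable_Borel.
pose f : Borel V -> R := \1_(U : set (Borel V)).
have If : Int f by exact: integrable_indic_fin.
have mf : measurable_fun setT f by exact: measurable_indic.
have f01 x : 0 <= f x <= 1 by rewrite /f indicE; case: (_ \in _); rewrite lexx ler01.
have f0 x : 0 <= f x by have /andP[] := f01 x.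
split => // e e0.
have h0 k x : 0 <= mollify k f x.
  by apply: Rintegral_ge0 => y _; rewrite mulr_ge0// moll_ge0// rad_gt0.
have h1 k x : mollify k f x <= 1.
  have [C KC] := @moll_bounded R n (rad k) (ltW (rad_gt0 k)).
  have Im : Int (fun y : Borel V => moll (rad k) (x - (y : V))).
    apply/integrableP; split.
      by apply/measurable_EFinP; exact: measurable_convr (@measurable_moll R n _).
    under eq_integral do rewrite /= ger0_norm ?moll_ge0 ?rad_gt0//.
    by rewrite integral_mollBr ?rad_gt0// ltry.
  rewrite (_ : 1 = \int[mu]_y moll (rad k) (x - (y : V))); last first.
    by rewrite /Rintegral integral_mollBr ?rad_gt0.
  apply: le_Rintegral => //; first exact: integrable_conv (@measurable_moll R n _) KC.
  by move=> y _; rewrite ler_piMl// ?moll_ge0 ?rad_gt0//; have /andP[] := f01 y.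
have Ih k : Int (mollify k f) by exact: (integrable_conv_moll (rad_gt0 k)).
have mh k : measurable_fun setT (mollify k f).
  by apply/measurable_EFinP; case/integrableP: (Ih k).
have hf k : \int[mu]_x mollify k f x = \int[mu]_x f x.
  apply: (congr1 fine).
  rewrite [RHS](eq_integral (fun x => `|f x|%:E)); last by move=> x _; rewrite ger0_norm.
  rewrite -(integral_norm_moll (rad_gt0 k) mf); apply: eq_integral => x _.
  have [C KC] := @moll_bounded R n (rad k) (ltW (rad_gt0 k)).
  rewrite /mollify /conv /Rintegral fineK.
    by apply: eq_integral => y _; rewrite ger0_norm.
  by apply: integrable_fin_num => //; exact: integrable_conv (@measurable_moll R n _) KC.
have Ifh k : Int (fun x => f x * mollify k f x).
  apply: (integrable_mul_bounded (C := 1)) => // x.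
  by rewrite ger0_norm.
(* As [f] takes the values 0 and 1 and [0 <= h <= 1] for the mollification [h], one has
   [|h - f| = h + f - 2 f h]; and [h] and [f] have the same integral. *)
have E k : nrm1 (fun x => mollify k f x - f x) =
    2 * (\int[mu]_x f x - \int[mu]_x (f x * mollify k f x)).
  transitivity (\int[mu]_x ((mollify k f x + f x) - 2 * (f x * mollify k f x))).
    apply: eq_Rintegral => x _; rewrite /f indicE; case: (_ \in _) => /=.
      by rewrite ler0_norm ?subr_le0//; ring.
    by rewrite subr0 ger0_norm//; ring.
  rewrite RintegralB//; [|exact: integrable_add|exact: integrable_scale].
  by rewrite RintegralD// RintegralZl// hf; ring.
have cv : (\int[mu]_x (f x * mollify k f x)%:E)%E @[k --> \oo] --> (\int[mu]_x (f x)%:E)%E.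
  have [] := @dominated_convergence _ _ _ mu setT measurableT
    (fun k x => (f x * mollify k f x)%:E) (fun x => (f x)%:E) (fun x => (f x)%:E).
  - by move=> k; apply/measurable_EFinP; exact: measurable_funM.
  - exact/measurable_EFinP.
  - apply: aeW => x _.
    have [Ux|nUx] := pselect (U x); last first.
      rewrite /f indicE memNset//=.
      rewrite (_ : (fun k => _) = cst 0%E); first exact: cvg_cst.
      by apply/funext => k; rewrite mul0r.
    (* Once [rad k] is below the distance [d] from [x] to the complement of [U], the kernel only
       sees [U] and the mollified value is exactly 1. *)
    apply: cvg_near_cst.
    have /nbhs_normP[d /= d0 dU] : nbhs (x : V) U by apply: open_nbhs_nbhs.
    near=> k; congr EFin.
    have rd : rad k < d.
      near: k; have := near_infty_natSinv_lt (PosNum d0); apply: filterS => k.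
      by rewrite /rad.
    rewrite [f x]indicE mem_set// mul1r.
    rewrite -[RHS](_ : \int[mu]_y moll (rad k) ((x : V) - (y : V)) = 1); last first.
      by rewrite /Rintegral integral_mollBr ?rad_gt0.
    apply: eq_Rintegral => y _.
    have [->|my] := eqVneq (moll (rad k) ((x : V) - (y : V))) 0; first by rewrite mulr0.
    rewrite /f indicE mem_set ?mul1r//; apply: dU => /=.
    have H := moll_supp (ltW (rad_gt0 k)) my.
    apply: le_lt_trans rd.
    rewrite /Num.Def.normr /= mx_normrE; apply/bigmax_leP; split; first by rewrite ltW// rad_gt0.
    by move=> [a b] _ /=; rewrite ord1; exact: H.
  - exact: If.
  - apply: aeW => x k _; rewrite lee_fin normrM (ger0_norm (f0 x)).
    by rewrite ger0_norm// ler_piMr.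
  - by [].
have /fine_cvgP[_] : (\int[mu]_x (f x * mollify k f x)%:E)%E @[k --> \oo] --> (\int[mu]_x f x)%:E.
  rewrite /Rintegral fineK//; exact: integrable_fin_num.
move=> /cvgrPdist_le /(_ (e / 2)); rewrite divr_gt0// => /(_ isT).
apply: filterS => k; rewrite E -/(Rintegral _ _ _) => H.
have := le_trans (ler_norm _) H; rewrite /=; rewrite /Rintegral; lra.
Unshelve. all: by end_near. Qed.

End L1_approximation.
Import HBSimple.

Section L1_approximation_all.
Context {R : realType} {n : nat}.
Local Notation V := 'rV[R]_n.
Local Notation mu := (lebRn R n).
Implicit Types (f g : Borel V -> R).
Local Notation Int f := (mu.-integrable setT (EFin \o f)).

(** Dominated convergence in the form that the density arguments use: one good index for each
    error. *)
Lemma nrm1_dominated (g : nat -> Borel V -> R) f G : (forall m, measurable_fun setT (g m)) ->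
  measurable_fun setT f -> Int G -> (forall x, g ^~ x @ \oo --> f x) ->
  (forall m x, `|g m x| <= G x) ->
  Int f /\ forall e, 0 < e -> exists m, nrm1 (fun x => f x - g m x) <= e.
Proof.
move=> mg mf IG gf gG.
have Ig m : Int (g m).
  apply: (@le_integrable _ _ _ _ _ measurableT _ (EFin \o G)) => //.
    exact/measurable_EFinP.
  by move=> x _ /=; rewrite lee_fin (le_trans (gG m x))// ler_norm.
have [] := @dominated_convergence _ _ _ mu setT measurableT
    (fun k x => (g k x)%:E) (fun x => (f x)%:E) (fun x => (G x)%:E).
- by move=> k; exact/measurable_EFinP.
- exact/measurable_EFinP.
- by apply: aeW => x _; apply: cvg_EFin => //; [exact: nearW|exact: gf].
- exact: IG.
- by apply: aeW => x k _; rewrite lee_fin.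
move=> If H _; split => // e e0.
have /fine_cvgP[_ /cvgrPdist_le /(_ e e0)] := H.
move=> [m _ /(_ m (leqnn m))] /=; rewrite sub0r normrN => H2.
exists m; apply: le_trans _ H2; apply: le_trans (ler_norm _).
rewrite /nrm1 /Rintegral le_eqVlt; apply/orP; left; apply/eqP; congr fine.
by apply: eq_integral => x _ /=; rewrite distrC.
Qed.

Local Notation C N := (@cube R n N.+1%:R).

Lemma open_cube (a : R) : 0 < a -> open (@cube R n a : set V).
Proof.
move=> a0; rewrite (_ : cube a = ball (0 : V) a); first exact: ball_open.
apply/seteqP; split => v /=.
  by move=> h; split => // i j; rewrite ord1 /ball /= mxE sub0r normrN.
by move=> [_ h] i; have := h 0 i; rewrite /ball /= mxE sub0r normrN.
Qed.

Lemma lebRn_cube_fin (E : set (Borel V)) N : measurable E -> (mu (E `&` C N) < +oo)%E.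
Proof.
move=> mE; have h : (mu (C N) < +oo)%E by rewrite lebRn_cube// ltry.
apply: le_lt_trans h; apply: le_measure; rewrite ?inE//.
- by apply: measurableI => //; exact: measurable_cube.
- exact: measurable_cube.
Qed.

(** Dynkin's theorem for the pi-system of open sets: complements are differences with the whole
    cube, disjoint unions are dominated limits of finite ones. The cube keeps every measure
    finite. *)
Lemma L1_approx_set (E : set (Borel V)) N : measurable E -> L1_approx (\1_(E `&` C N)).
Proof.
move=> mE.
pose P (E : set (Borel V)) := L1_approx (\1_(E `&` C N)).
have PO (U : set V) : open U -> P U.
  move=> oU; apply: L1_approx_open; first by apply: openI => //; exact: open_cube.
  by apply: lebRn_cube_fin; exact: open_measurable_Borel.
suff : P E by [].
apply: (@dynkin_induction _ (Borel V) (@open V) P) => //.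
- by move=> A B oA oB; exact: openI.
- by apply: PO; exact: openT.
- move=> S mS PS; rewrite /P (_ : \1__ = (fun x => \1_(setT `&` C N) x + (-1) * \1_(S `&` C N) x)).
    by apply: L1_approxD; [exact/PO/openT|exact: L1_approxZ].
  apply/funext => x; rewrite !indicE !in_setI in_setC in_setT /=.
  by case: (x \in S); case: (x \in C N) => /=; ring.
- move=> F mF tF PF.
  pose g m : Borel V -> R := \1_((\big[setU/set0]_(i < m) F i) `&` C N).
  have Pg m : L1_approx (g m).
    elim: m => [|m IH].
      rewrite /g big_ord0 set0I (_ : \1_set0 = (fun x => 0 * \1_(setT `&` C N) x)).
        by apply: L1_approxZ; exact/PO/openT.
      by apply/funext => x; rewrite indic0 mul0r.
    rewrite /g big_ord_recr /= (_ : \1__ = (fun x => g m x + \1_(F m `&` C N) x)).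
      by apply: L1_approxD => //; exact: PF.
    apply/funext => x; rewrite /g !indicE !in_setI in_setU.
    have : ~~ ((x \in \big[setU/set0]_(i < m) F i) && (x \in F m)).
      apply/negP => /andP[]; rewrite !inE -bigcup_mkord => -[i /= im Fi] Fm.
      move/trivIsetP : tF => /(_ i m I I); rewrite neq_ltn im => /(_ isT).
      by apply/eqP/set0P; exists x.
    by case: (x \in \big[setU/set0]_(i < m) F i); case: (x \in F m);
      case: (x \in C N) => //= _; ring.
  have mUF : measurable (\bigcup_k F k) by exact: bigcup_measurable.
  have mC : measurable (C N) by exact: measurable_cube.
  have mI : measurable (\bigcup_k F k `&` C N) by exact: measurableI.
  have [] := @nrm1_dominated g (\1_(\bigcup_k F k `&` C N)) (\1_(\bigcup_k F k `&` C N)).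
  + move=> m; apply: measurable_indic; apply: measurableI => //.
    by apply: bigsetU_measurable.
  + exact: measurable_indic.
  + by apply: integrable_indic_fin => //; exact: lebRn_cube_fin.
  + move=> x; have [[[k _ Fk] Cx]|nx] := pselect ((\bigcup_k F k `&` C N) x).
      apply: cvg_near_cst; exists k.+1 => // m /= km.
      rewrite /g !indicE !mem_set//; first by split => //; exists k.
      by split => //; rewrite -bigcup_mkord; exists k.
    apply: cvg_near_cst; apply: nearW => m.
    rewrite /g !indicE !memNset//; apply: contra_not nx => -[+ Cx].
    by rewrite -bigcup_mkord => -[k _ Fk]; split => //; exists k.
  + move=> m x; rewrite /g !indicE.
    have [h|nx] := pselect (((\big[setU/set0]_(i < m) F i) `&` C N) x).
      rewrite !mem_set ?normr1//; case: h => + Cx.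
      by rewrite -bigcup_mkord => -[k _ Fk]; split => //; exists k.
    by rewrite memNset// normr0.
  move=> If H; apply: L1_approx_lim => // e /H[m Hm].
  by exists (g m).
Qed.

(** Simple functions cut off to large cubes are dense in L^1, and each of them is a finite
    combination of the indicators of [L1_approx_set]. *)
Lemma L1_approx_integrable f : Int f -> L1_approx f.
Proof.
move=> If; apply: L1_approx_lim => // e e0; have e2 : 0 < e / 2 by rewrite divr_gt0.
have [g [Ig _ /fine_cvgP[_ /cvgrPdist_le /(_ _ e2)]]] := approximation_sfun_integrable measurableT If.
move=> [k _ /(_ k (leqnn k))] /=; rewrite sub0r normrN => fg.
pose h m x := g k x * \1_(C m) x.
have mC m : measurable (C m) by exact: measurable_cube.
have [_ /(_ _ e2)[m Hm]] : Int (g k) /\ forall e, 0 < e -> exists m, nrm1 (fun x => g k x - h m x) <= e.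
  apply: (@nrm1_dominated h (g k) (fun x => `|g k x|)) => //.
  - by move=> m; apply: measurable_funM => //; exact: measurable_indic.
  - exact: integrable_norm (Ig k).
  - move=> x; apply: cvg_near_cst.
    near=> m; rewrite /h indicE mem_set ?mulr1// => i.
    apply: le_lt_trans (coord_le_norm _ _) _.
    apply: (@lt_le_trans _ _ m%:R); last by rewrite ler_nat.
    by near: m; exact: nbhs_infty_gtr.
  - move=> m x; rewrite /h indicE normrM; case: (_ \in _); first by rewrite normr1 mulr1.
    by rewrite normr0 mulr0.
have [s Es] : exists s : seq R, forall x, g k x = \sum_(y <- s) y * \1_(g k @^-1` [set y]) x.
  exists (finmap.enum_fset (fset_set (range (g k)))) => x.
  by rewrite fimfunE fsbig_finite.
exists (h m).
  rewrite (_ : h m = (fun x => \sum_(y <- s) y * \1_(g k @^-1` [set y] `&` C m) x)).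
    elim: s {Es} => [|y s IH].
      rewrite (_ : (fun _ => _) = (fun x => 0 * \1_(setT `&` C m) x)).
        by apply: L1_approxZ; exact: L1_approx_set.
      by apply/funext => x; rewrite big_nil mul0r.
    rewrite (_ : (fun _ => _) = (fun x => y * \1_(g k @^-1` [set y] `&` C m) x +
      \sum_(y <- s) y * \1_(g k @^-1` [set y] `&` C m) x)); last by apply/funext => x; rewrite big_cons.
    by apply: L1_approxD => //; apply: L1_approxZ; exact: L1_approx_set.
  apply/funext => x; rewrite /h Es big_distrl/=.
  by apply: eq_bigr => y _; rewrite -mulrA !indicE in_setI; case: (_ \in _); case: (_ \in _); rewrite /= ?mulr1 ?mulr0.
have Igk := Ig k; have Ih : Int (h m).
  apply: (integrable_mul_bounded (C := 1) Igk); first exact: measurable_indic.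
  by move=> x; rewrite indicE; case: (_ \in _); rewrite ?normr1 ?normr0.
rewrite (_ : (fun _ => _) = (fun x => (f x - g k x) + (g k x - h m x))); last first.
  by apply/funext => x; rewrite addrA subrK.
apply: (le_trans (nrm1D (integrable_sub If Igk) (integrable_sub Igk Ih))).
rewrite (splitr e) lerD//; apply: le_trans _ fg.
by apply: le_trans (ler_norm _).
Unshelve. all: by end_near. Qed.

End L1_approximation_all.
(** * Coarea inequality *)

Section layers.
Context {R : realType} {n : nat}.
Local Notation V := 'rV[R]_n.
Local Notation mu := (lebRn R n).
Local Notation Int f := (mu.-integrable setT (EFin \o f)).

Lemma euclid_norm_sq (w : V) : euclid_norm w ^+ 2 = \sum_i w 0 i ^+ 2.
Proof. by rewrite sqr_sqrtr// sumr_ge0// => i _; exact: sqr_ge0. Qed.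

Lemma euclid_norm_ge0 (w : V) : 0 <= euclid_norm w.
Proof. exact: sqrtr_ge0. Qed.

(** Duality replaces the norm bound by inequalities linear in [a], which pass through weighted sums
    and integrals of fields. *)
Lemma euclid_norm_le1P (a : V) :
  euclid_norm a <= 1 <-> forall w : V, \sum_i w 0 i * a 0 i <= euclid_norm w.
Proof.
split => [a1 w|/(_ a) H]; last first.
  have : euclid_norm a ^+ 2 <= euclid_norm a.
    by rewrite euclid_norm_sq; under eq_bigr do rewrite expr2.
  have := euclid_norm_ge0 a; rewrite le_eqVlt => /predU1P[<- _|a0]; first exact: ler01.
  by rewrite expr2 ger_pMr.
have a21 : euclid_norm a ^+ 2 <= 1 by rewrite expr_le1// euclid_norm_ge0.
have := euclid_norm_ge0 w; rewrite le_eqVlt => /predU1P[w0|w0].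
  rewrite -w0 big1// => i _.
  have /eqP : \sum_i w 0 i ^+ 2 = 0 by rewrite -euclid_norm_sq -w0 expr0n.
  rewrite psumr_eq0; last by move=> j _; exact: sqr_ge0.
  by move=> /allP/(_ i (mem_index_enum _)); rewrite sqrf_eq0 => /eqP ->; rewrite mul0r.
set N := euclid_norm w in w0 *.
(* Expanding this square and using [|a| <= 1] gives the Cauchy-Schwarz inequality in the form
   wanted. *)
have : 0 <= \sum_i (w 0 i - N * a 0 i) ^+ 2 by apply: sumr_ge0 => i _; exact: sqr_ge0.
rewrite (_ : \sum_i _ = N ^+ 2 + N ^+ 2 * euclid_norm a ^+ 2 - 2 * N * \sum_i w 0 i * a 0 i); last first.
  rewrite /N !euclid_norm_sq -/N !mulr_sumr -sumrN -!big_split /=.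
  by apply: eq_bigr => i _; rewrite -[in X in _ + X + _]euclid_norm_sq -/N; ring.
move=> H; rewrite -(ler_pM2l w0); nra.
Qed.

Lemma C10_field_supp (phi : V -> V) : C10_field phi ->
  exists r, forall i, supp_in r (fun x => phi x 0 i).
Proof.
move=> [_ /compact_bounded[M [_ /(_ (M + 1))]]]; rewrite ltrDl ltr01 => /(_ isT) h.
exists (M + 1) => i x px j; apply: le_trans (coord_le_norm _ _) _.
apply: h; apply: subset_closure => /=.
by apply: contra px => /eqP ->; rewrite mxE.
Qed.

Lemma C1_with_C10_field r (psi : 'I_n -> V -> R) dpsi :
  (forall i, C1_with (psi i) (dpsi i)) -> (forall i, supp_in r (psi i)) ->
  C10_field (fun x => \row_i psi i x).
Proof.
move=> C1p pr; split => [i|].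
  rewrite (_ : (fun _ => _) = psi i); first exact: C1_with_Ck (C1p i).
  by apply/funext => x; rewrite mxE.
(* The indicator of the set where the field is nonzero, a scalar function to which [supp_in_compact]
   applies. *)
pose K x : R := (`[< \row_i psi i x != 0 >])%:R.
have KE : [set x | K x != 0] = [set x | \row_i psi i x != 0].
  by apply/seteqP; split => x /=; rewrite /K pnatr_eq0 eqb0 negbK; [move/asboolP|move=> ?; exact/asboolP].
have Kr : supp_in r K.
  move=> x /= Kx; have : [set x | K x != 0] x by [].
  rewrite KE /= => px; suff [i pi] : exists i, psi i x != 0 by exact: (pr i x pi).
  apply/existsP; rewrite -negb_forall; apply: contra px => /forallP px.
  by apply/eqP/rowP => i; rewrite !mxE; exact/eqP/px.
by have := supp_in_compact Kr; rewrite KE.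
Qed.

Lemma lipschitz_derive (g dg : R -> R) : (forall s, is_derive s (1 : R) g (dg s)) ->
  (forall s, `|dg s| <= 1) -> forall a b, `|g b - g a| <= `|b - a|.
Proof.
move=> gd dg1.
have cg : continuous g.
  by move=> s; apply/differentiable_continuous/derivable1_diffP; exact: (@ex_derive _ _ _ _ _ _ _ (gd s)).
suff H a b : a < b -> `|g b - g a| <= `|b - a|.
  move=> a b; have [ab|ba|->] := ltgtP a b; [exact: H| |by rewrite !subrr].
  by rewrite distrC [leRHS]distrC; exact: H.
move=> ab; have [c _ ->] := MVT ab (fun x _ => gd x) (continuous_subspaceT cg).
by rewrite normrM ler_piMl.
Qed.

Lemma divRn_bounded phi : C10_field phi ->
  measurable_fun (setT : set (Borel V)) (divRn phi) /\ exists C, forall x, `|divRn phi x| <= C.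
Proof.
move=> C10; have [r rP] := C10_field_supp C10; have [Cphi _] := C10.
have C1 i := Ck_C1_with (Cphi i).
have cdiv : continuous (divRn phi).
  rewrite (_ : divRn phi = \sum_i (fun x => partial i (fun y => phi y 0 i) x)); last first.
    by apply/funext => x; rewrite fct_sumE.
  elim/big_ind : _ => [|f g cf cg|i _]; first exact: cst_continuous.
    exact: continuous_addr.
  by have [_ /(_ i)[]] := C1 i.
split; first exact: continuous_measurable_Borel.
apply: (@supp_in_bounded _ _ r) => //.
move=> x dx l; rewrite leNgt; apply/negP => rx; move/eqP : dx; apply.
rewrite /divRn big1// => i _.
by apply: (supp_in0 (C1_with_supp (C1 i) (rP i) (i := i))); exists l.
Qed.

Variables (J : nat) (eta deta : 'I_J -> R -> R) (phi : 'I_J -> V -> V).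
Variable u : Borel V -> R.
Hypothesis eta_derive : forall j s, is_derive s (1 : R) (eta j) (deta j s).
Hypothesis deta_continuous : forall j, continuous (deta j).
Hypothesis deta_ge0 : forall j s, 0 <= deta j s.
Hypothesis deta_sum : forall s, \sum_j deta j s <= 1.
Hypothesis phi_C1 : forall j, C10_field (phi j).
Hypothesis phi_le1 : forall j x, euclid_norm (phi j x) <= 1.
Hypothesis Iu : Int u.

Let eta_continuous j : continuous (eta j).
Proof.
by move=> s; apply/differentiable_continuous/derivable1_diffP; exact: (@ex_derive _ _ _ _ _ _ _ (eta_derive j s)).
Qed.

Let deta_le1 j s : `|deta j s| <= 1.
Proof.
rewrite ger0_norm//; apply: le_trans (deta_sum s).
by rewrite (bigD1 j)//= lerDl sumr_ge0.
Qed.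

Let phi_C1_with j i : C1_with (fun x => phi j x 0 i) (fun k => partial k (fun x => phi j x 0 i)).
Proof. by have [/(_ i)/Ck_C1_with] := phi_C1 j. Qed.

Let phi_supp : exists r, forall j i, supp_in r (fun x => phi j x 0 i).
Proof.
have /choice[r rP] : forall j, exists r, forall i, supp_in r (fun x => phi j x 0 i).
  by move=> j; exact: C10_field_supp.
exists (\big[Num.max/0]_j r j) => j i; apply: supp_in_le (rP j i).
exact: le_bigmax.
Qed.

(* The test field for [u] is [moll * chi] with [chi = \sum_j deta j (v) phi j],
   [v] being the mollification of [u]; it has norm at most 1 since the weights
   [deta j (v)] sum to at most 1. *)
Lemma layers_mollify (k : nat) :
  ((\sum_j \int[mu]_x (eta j (mollify k u x) * divRn (phi j) x))%:E <= tvRn u)%E.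
Proof.
have [r rP] := phi_supp.
have rk := rad_gt0 (R := R) k.
pose v := mollify k u.
pose dv i := conv u (dmoll (rad k) i).
have C1v : C1_with v dv := conv_C1 Iu (moll_C1 (rad k)) (moll_supp (ltW rk)).
have cv : continuous v := C1v.1.
have cdv i : continuous (dv i) by have [_ /(_ i)[]] := C1v.
pose chi i x := \sum_j deta j (v x) * phi j x 0 i.
have cphi j i : continuous (fun x => phi j x 0 i) := (phi_C1_with j i).1.
have cchij j i : continuous (fun x => deta j (v x) * phi j x 0 i).
  by apply: continuous_mulr => //; exact: continuous_compr.
have cchi i : continuous (chi i).
  rewrite (_ : chi i = \sum_j (fun x => deta j (v x) * phi j x 0 i)); last first.
    by apply/funext => x; rewrite fct_sumE.
  elim/big_ind : _ => [|f g cf cg|j _]; first exact: cst_continuous.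
    exact: continuous_addr.
  exact: cchij.
have schi i : supp_in r (chi i).
  move=> x cx l; rewrite leNgt; apply/negP => rx; move/eqP : cx; apply.
  by rewrite /chi big1// => j _; rewrite (supp_in0 (rP j i)) ?mulr0//; exists l.
have chi1 x : euclid_norm (\row_i chi i x) <= 1.
  apply/euclid_norm_le1P => w.
  rewrite (_ : \sum_i _ = \sum_j deta j (v x) * \sum_i (w 0 i * phi j x 0 i)); last first.
    under [RHS]eq_bigr do rewrite mulr_sumr.
    rewrite exchange_big /=; apply: eq_bigr => i _; rewrite mxE mulr_sumr.
    by apply: eq_bigr => j _; rewrite mulrCA.
  apply: (@le_trans _ _ (\sum_j deta j (v x) * euclid_norm w)).
    apply: ler_sum => j _; rewrite ler_wpM2l//.
    by have /euclid_norm_le1P := phi_le1 j x; exact.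
  by rewrite -mulr_suml ler_piMl// euclid_norm_ge0.
have Ichi i : Int (chi i) := supp_in_cts_integrable (cchi i) (schi i).
pose psi i := conv (chi i) (moll (rad k)).
pose dpsi i l := conv (chi i) (dmoll (rad k) l).
have C1psi i : C1_with (psi i) (dpsi i) := conv_C1 (Ichi i) (moll_C1 (rad k)) (moll_supp (ltW rk)).
have spsi i : supp_in (r + rad k) (psi i) := conv_supp (schi i) (moll_supp (ltW rk)).
have C10psi := C1_with_C10_field C1psi spsi.
have [Cm mCm] := moll_bounded (R := R) (n := n) (ltW rk).
(* Tested against each [w], the bound on [chi] is averaged with respect to a probability density and
   so survives. *)
have psi1 x : euclid_norm (\row_i psi i x) <= 1.
  apply/euclid_norm_le1P => w.
  have Ip i := integrable_conv x (Ichi i) (@measurable_moll R n (rad k)) mCm.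
  apply: (@le_trans _ _ (\int[mu]_y (euclid_norm w * moll (rad k) (x - (y : V))))); last first.
    rewrite RintegralZl//.
      by rewrite {1}/Rintegral integral_mollBr//= mulr1.
    apply/integrableP; split.
      by apply/measurable_EFinP; exact: measurable_convr (@measurable_moll R n _).
    under eq_integral do rewrite /= ger0_norm ?moll_ge0//.
    by rewrite integral_mollBr// ltry.
  have Iw i := integrable_scale (w 0 i) (Ip i).
  have -> : \sum_i w 0 i * (\row_i psi i x) 0 i =
      \int[mu]_y \sum_i w 0 i * (chi i y * moll (rad k) (x - (y : V))).
    rewrite Rintegral_sumr//; apply: eq_bigr => i _.
    by rewrite RintegralZl// mxE.
  apply: le_Rintegral => //; first exact: integrable_sumr.
    apply: integrable_scale; apply/integrableP; split.
      by apply/measurable_EFinP; exact: measurable_convr (@measurable_moll R n _).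
    under eq_integral do rewrite /= ger0_norm ?moll_ge0//.
    by rewrite integral_mollBr// ltry.
  move=> y _; under eq_bigr do rewrite mulrA.
  rewrite -mulr_suml ler_wpM2r ?moll_ge0//.
  have /euclid_norm_le1P/(_ w) := chi1 y.
  by under eq_bigr do rewrite mxE.
have [Cd dCd] : exists C : R, forall (i : 'I_n) (z : V), `|dmoll (rad k) i z| <= C.
  have /choice[C CP] : forall i : 'I_n, exists C : R, forall z : V, `|dmoll (rad k) i z| <= C.
    by move=> i; exact: dmoll_bounded (ltW rk).
  exists (\big[Num.max/0]_i C i) => i z; apply: le_trans (CP i z) _.
  exact: le_bigmax.
(* The derivative, carried by the kernel, goes over to [u] by [conv_adj]; the reflected kernel is
   minus [dmoll], whence the sign. *)
have adj i : \int[mu]_x (u x * dpsi i i x) = - \int[mu]_x (chi i x * dv i x).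
  rewrite (conv_adj (Ichi i) Iu (@measurable_dmoll R n (rad k) i) (dCd i)).
  rewrite -mulN1r -RintegralZl//; last first.
    apply: supp_in_cts_integrable (continuous_mulr (cchi i) (cdv i)) _ => x cx.
    by apply: (schi i); apply: contra cx => /eqP ->; rewrite mul0r.
  apply: eq_Rintegral => x _; rewrite mulrCA; congr (_ * _).
  rewrite /dv /conv -RintegralZl//; last exact: integrable_conv Iu (@measurable_dmoll R n (rad k) i) (dCd i).
  by apply: eq_Rintegral => y _; rewrite dmollN; ring.
have Ipart j i : Int (fun x => eta j (v x) * partial i (fun y => phi j y 0 i) x).
  have [_ /(_ i)[cp _]] := phi_C1_with j i.
  apply: (@supp_in_cts_integrable _ _ r).
    by apply: continuous_mulr => //; apply: continuous_compr.
  move=> x px; apply: (C1_with_supp (phi_C1_with j i) (rP j i) (i := i)).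
  by apply: contra px => /eqP ->; rewrite mulr0.
(* Integration by parts: the derivative of the compactly supported product of [eta j (v)] and a
   component of [phi j] has integral 0. *)
have ibp j i : \int[mu]_x (eta j (v x) * partial i (fun y => phi j y 0 i) x) =
    - \int[mu]_x (deta j (v x) * phi j x 0 i * dv i x).
  have C1e := C1_with_comp C1v (@eta_continuous j) (@deta_continuous j) (@eta_derive j).
  have := Rintegral_partial0 i (C1_withM C1e (phi_C1_with j i)) (r := r).
  have sF : supp_in r (fun x => eta j (v x) * phi j x 0 i).
    by move=> x px; apply: (rP j i); apply: contra px => /eqP ->; rewrite mulr0.
  move=> /(_ sF); rewrite RintegralD//; last first.
    apply: (@supp_in_cts_integrable _ _ r).
      apply: continuous_mulr => //; apply: continuous_mulr => //.
      exact: continuous_compr.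
    by move=> x px; apply: (rP j i); apply: contra px => /eqP ->; rewrite mul0r.
  move=> /eqP; rewrite addr_eq0 => /eqP ->; congr (- _).
  by apply: eq_Rintegral => x _; ring.
have Iup i : Int (fun x => u x * dpsi i i x).
  have [_ /(_ i)[cdp _]] := C1psi i.
  have [C CP] := supp_in_bounded cdp (C1_with_supp (C1psi i) (spsi i) (i := i)).
  exact: integrable_mul_bounded Iu (continuous_measurable_Borel cdp) CP.
have Ichidv j i : Int (fun x => deta j (v x) * phi j x 0 i * dv i x).
  apply: (@supp_in_cts_integrable _ _ r).
    exact: continuous_mulr.
  by move=> x px; apply: (rP j i); apply: contra px => /eqP ->; rewrite mulr0 mul0r.
have divE x : divRn (fun x => \row_i psi i x) x = \sum_i dpsi i i x.
  apply: eq_bigr => i _; rewrite -(C1_with_partial i (C1psi i)).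
  by rewrite (_ : (fun y => _) = psi i)//; apply/funext => y; rewrite mxE.
have -> : \sum_j \int[mu]_x (eta j (mollify k u x) * divRn (phi j) x) =
    \int[mu]_x (u x * divRn (fun x => \row_i psi i x) x).
  transitivity (\sum_i \int[mu]_x (u x * dpsi i i x)).
    under [RHS]eq_bigr do rewrite adj.
    transitivity (\sum_j \sum_i - \int[mu]_x (deta j (v x) * phi j x 0 i * dv i x)).
      apply: eq_bigr => j _; under [RHS]eq_bigr do rewrite -ibp.
      rewrite -(Rintegral_sumr _ (Ipart j)); apply: eq_Rintegral => x _.
      by rewrite /divRn mulr_sumr.
    rewrite exchange_big /=; apply: eq_bigr => i _.
    rewrite sumrN -(Rintegral_sumr _ (fun j => Ichidv j i)); congr (- _).
    by apply: eq_Rintegral => x _; rewrite mulr_suml.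
  rewrite -(Rintegral_sumr _ Iup); apply: eq_Rintegral => x _.
  by rewrite divE mulr_sumr.
apply: ereal_sup_ubound; exists (fun x => \row_i psi i x) => //.
rewrite /Rintegral fineK//; apply: integrable_fin_num => //.
have := integrable_sumr (index_enum _) Iup; apply: eq_integrable => // x _ /=.
by rewrite divE mulr_sumr.
Qed.

Hypothesis eta0 : forall j, eta j 0 = 0.

Let eta_lipschitz j a b : `|eta j b - eta j a| <= `|b - a|.
Proof. exact: lipschitz_derive. Qed.

Lemma layer_le j s : `|eta j s| <= `|s|.
Proof. by have := eta_lipschitz j 0 s; rewrite eta0 !subr0. Qed.

Lemma integrable_layer j : Int (fun x => eta j (u x)).
Proof.
have mu_ : measurable_fun setT u by apply/measurable_EFinP; case/integrableP: Iu.
apply: (@le_integrable _ _ _ _ _ measurableT _ (EFin \o u)) => //.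
  apply/measurable_EFinP; apply: measurableT_comp => //.
  exact: continuous_measurable_fun.
by move=> x _ /=; rewrite lee_fin layer_le.
Qed.

(** Passage from [mollify k u] to [u]: each [eta j] is 1-Lipschitz and each divergence is bounded by
    [C], so the sum moves by at most [J C] times the L^1 distance. The constant [c] below adds 1 to
    [J C] to be positive. *)
Lemma layers_tv : ((\sum_j \int[mu]_x (eta j (u x) * divRn (phi j) x))%:E <= tvRn u)%E.
Proof.
have [C [C0 CP]] : exists C : R, 0 <= C /\ forall (j : 'I_J) (x : V), `|divRn (phi j) x| <= C.
  have /choice[C CP] : forall j : 'I_J, exists C : R, forall x : V, `|divRn (phi j) x| <= C.
    by move=> j; have [_] := divRn_bounded (phi_C1 j).
  exists (\big[Num.max/0]_j C j); split; first exact: bigmax_ge_id.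
  by move=> j x; apply: le_trans (CP j x) _; exact: le_bigmax.
apply/lee_addgt0Pr => e e0.
pose c := J%:R * C + 1.
have c0 : 0 < c by rewrite ltr_wpDl// mulr_ge0.
have [_ /(_ (e / c))] := L1_approx_integrable Iu.
rewrite divr_gt0// => /(_ isT) [k _ /(_ k (leqnn k))] /= Hk.
have rk := rad_gt0 (R := R) k.
have Iv : Int (mollify k u) := integrable_conv_moll rk Iu.
have cv : continuous (mollify k u) := (conv_C1 Iu (moll_C1 (rad k)) (moll_supp (ltW rk))).1.
have mdiv j : measurable_fun (setT : set (Borel V)) (divRn (phi j)).
  by have [] := divRn_bounded (phi_C1 j).
have Iev j : Int (fun x => eta j (mollify k u x)).
  apply: (@le_integrable _ _ _ _ _ measurableT _ (EFin \o mollify k u)) => //.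
    by apply/measurable_EFinP; apply: continuous_measurable_Borel; exact: continuous_compr.
  by move=> x _ /=; rewrite lee_fin layer_le.
have I1 j : Int (fun x => eta j (u x) * divRn (phi j) x).
  exact: integrable_mul_bounded (integrable_layer j) (mdiv j) (CP j).
have I2 j : Int (fun x => eta j (mollify k u x) * divRn (phi j) x).
  exact: integrable_mul_bounded (Iev j) (mdiv j) (CP j).
have Ivu := integrable_sub Iv Iu.
have key j : \int[mu]_x (eta j (u x) * divRn (phi j) x) <=
    \int[mu]_x (eta j (mollify k u x) * divRn (phi j) x) + C * (e / c).
  apply: (@le_trans _ _ (\int[mu]_x (eta j (mollify k u x) * divRn (phi j) x +
      C * `|mollify k u x - u x|))); last first.
    rewrite RintegralD//; last by apply: integrable_scale; exact: (integrable_norm Ivu).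
    by rewrite lerD2l RintegralZl//; [rewrite ler_wpM2l|exact: (integrable_norm Ivu)].
  apply: (le_Rintegral measurableT (I1 j) (integrable_add (I2 j) (integrable_scale C (integrable_norm Ivu)))).
  move=> x _; rewrite -lerBlDl -mulrBl; apply: le_trans (ler_norm _) _.
  rewrite normrM mulrC; apply: ler_pM => //.
  by apply: le_trans (eta_lipschitz _ _ _) _; rewrite distrC.
apply: le_trans (leeD2r _ (layers_mollify k)); rewrite -EFinD lee_fin.
apply: (@le_trans _ _ (\sum_j (\int[mu]_x (eta j (mollify k u x) * divRn (phi j) x) + C * (e / c)))).
  by apply: ler_sum => j _; exact: key.
rewrite big_split /= lerD2l sumr_const card_ord -mulr_natl mulrA mulrCA.
by rewrite ler_piMr ?(ltW e0)// ler_pdivrMr// mul1r /c lerDl.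
Qed.

End layers.

(** * Truncations of class C^1 and their telescoping sums *)

Section ramps.
Variable R : realType.
Implicit Types (t d s : R).

(** The piecewise linear step from 0 on [s <= 0] to 1 on [s >= d], written with positive parts so
    that its primitive is a difference of [pos2]. *)
Definition clampf d s : R := (Num.max s 0 - Num.max (s - d) 0) / d.

(* The antiderivative of [clampf], a C^1 substitute for [max s 0]: truncating at
   a level with it keeps the chain rule elementary. *)
Definition softpos d s : R := (pos2 s - pos2 (s - d)) / (2 * d).

Lemma clampf_ge0 d s : 0 < d -> 0 <= clampf d s.
Proof.
move=> d0; rewrite /clampf divr_ge0 ?(ltW d0)//.
by case: (leP s 0) => s0; case: (leP (s - d) 0) => h0; lra.
Qed.

Lemma clampf_le1 d s : 0 < d -> clampf d s <= 1.
Proof.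
move=> d0; rewrite /clampf ler_pdivrMr// mul1r.
by case: (leP s 0) => s0; case: (leP (s - d) 0) => h0; lra.
Qed.

Lemma clampf_eq0 d s : 0 < d -> s <= 0 -> clampf d s = 0.
Proof.
move=> d0 s0; rewrite /clampf !max_r ?subrr ?mul0r//; lra.
Qed.

Lemma clampf_le d s s' : 0 < d -> s <= s' -> clampf d s <= clampf d s'.
Proof.
move=> d0 ss; rewrite /clampf ler_pM2r ?invr_gt0//.
by case: (leP s 0) => ?; case: (leP (s - d) 0) => ?; case: (leP s' 0) => ?;
  case: (leP (s' - d) 0) => ?; lra.
Qed.

Lemma is_derive_softpos t d s : 0 < d ->
  is_derive s (1 : R) (fun s => softpos d (s - t)) (clampf d (s - t)).
Proof.
(* The constant comes from two remainders of [pos2], each at most [h^2], over [2 d]. *)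
move=> d0; apply: (@is_derive_quad R R^o _ s 1 _ (1 / d)) => h _.
rewrite /softpos /clampf [_ *: _]mulr1.
have A := pos2_quad (s - t) h; have B := pos2_quad (s - t - d) h.
have -> : h + s - t = h + (s - t) by ring.
have -> : h + (s - t) - d = h + (s - t - d) by ring.
set x := pos2 _ in A *; set y := pos2 _ in B *.
set x' := pos2 _ in A *; set y' := pos2 _ in B *.
set m := Num.max _ _ in A *; set m' := Num.max _ _ in B *.
rewrite (_ : _ - _ = ((x - x' - h * (2 * m)) - (y - y' - h * (2 * m'))) / (2 * d)); last first.
  by field; rewrite gt_eqF.
have d20 : 0 < 2 * d by rewrite mulr_gt0.
rewrite normrM normfV (gtr0_norm d20).
rewrite ler_pdivrMr ?mulr_gt0//.
rewrite (_ : _ * (2 * d) = h ^+ 2 + h ^+ 2); last by field; rewrite gt_eqF.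
by apply: le_trans (ler_normB _ _) _; exact: lerD.
Qed.

Lemma continuous_clampf t d : continuous (fun s => clampf d (s - t)).
Proof.
have c1 (a : R) : continuous (fun s : R => Num.max (s - a) 0).
  by apply: continuous_pos => s; apply: cvgB; [exact: cvg_id|exact: cvg_cst].
move=> s; rewrite /clampf; apply: cvgM; last exact: cvg_cst.
apply: cvgB; first exact: c1.
under eq_fun do rewrite -addrA -opprD.
rewrite -addrA -opprD; exact: c1.
Qed.

Lemma softpos_bounds d s : 0 < d -> s - d / 2 <= softpos d s <= Num.max s 0.
Proof.
move=> d0; rewrite /softpos /pos2 ler_pdivrMr ?mulr_gt0// ler_pdivlMr ?mulr_gt0//.
case: (leP s 0) => ?; case: (leP (s - d) 0) => ?; apply/andP; split; nra.
Qed.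

(** A C^1 version of the truncation of [s - t] to the interval from 0 to [d]. The smoothing doubles
    the width: the value [d] is reached at [t + 2 d], so the transition zones of consecutive levels
    overlap in pairs. *)
Definition ramp t d s : R := softpos d (s - t) - softpos d (s - t - d).

Lemma ramp_eq0 t d s : 0 < d -> s <= t -> ramp t d s = 0.
Proof.
move=> d0 st; rewrite /ramp /softpos /pos2 !max_r; lra.
Qed.

Lemma ramp_eqd t d s : 0 < d -> t + d + d <= s -> ramp t d s = d.
Proof.
move=> d0 st; rewrite /ramp /softpos /pos2 !max_l; try lra.
by field; rewrite gt_eqF.
Qed.

Lemma ramp_bounds t d s : 0 < d -> 0 <= ramp t d s <= d.
Proof.
move=> d0; rewrite /ramp /softpos -mulrBl ler_pdivlMr ?mulr_gt0// mul0r ler_pdivrMr ?mulr_gt0//.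
rewrite /pos2; case: (leP (s - t) 0) => ?; case: (leP (s - t - d) 0) => ?;
  case: (leP (s - t - d - d) 0) => ?; apply/andP; split; nra.
Qed.

(* The odd extension of [ramp] treats the superlevel sets of [u] and [- u] at once. *)
Definition layer t d s : R := ramp t d s - ramp t d (- s).

Definition dlayer t d s : R := (clampf d (s - t) - clampf d (s - (t + d))) +
  (clampf d (- s - t) - clampf d (- s - (t + d))).

Lemma layer0 t d : layer t d 0 = 0.
Proof. by rewrite /layer oppr0 subrr. Qed.

(** As [t >= 0], at most one of the two ramps is nonzero at a given [s]. *)
Lemma norm_layer t d s : 0 < d -> 0 <= t -> `|layer t d s| = ramp t d `|s|.
Proof.
move=> d0 t0; rewrite /layer; case: (leP 0 s) => s0.
  rewrite [ramp t d (- s)]ramp_eq0 ?subr0//; last lra.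
  by rewrite (ger0_norm s0) ger0_norm//; have /andP[] := ramp_bounds t s d0.
rewrite [ramp t d s]ramp_eq0 ?sub0r ?normrN//; last lra.
by rewrite (ltr0_norm s0) ger0_norm//; have /andP[] := ramp_bounds t (- s) d0.
Qed.

Lemma is_derive_ramp t d s : 0 < d ->
  is_derive s (1 : R) (ramp t d) (clampf d (s - t) - clampf d (s - (t + d))).
Proof.
move=> d0; rewrite (_ : ramp t d = (fun s => softpos d (s - t)) \- (fun s => softpos d (s - (t + d)))).
  exact: (@is_deriveB _ _ _ _ _ _ _ _ _ (is_derive_softpos t s d0) (is_derive_softpos (t + d) s d0)).
by apply/funext => x; rewrite /ramp /=; congr (_ - softpos _ _); ring.
Qed.

Lemma is_derive_layer t d s : 0 < d -> is_derive s (1 : R) (layer t d) (dlayer t d s).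
Proof.
move=> d0.
have D : is_derive s (1 : R) (fun s => ramp t d (- s) : R^o)
    ((clampf d (- s - t) - clampf d (- s - (t + d))) * -1).
  apply: (@is_derive_scomp R R^o (fun s : R => - s : R^o) (ramp t d) s 1 (-1)).
  exact: is_derive_ramp.
have := @is_deriveB _ _ _ _ _ _ _ _ _ (is_derive_ramp t s d0) D.
by rewrite mulrN1 opprK.
Qed.

Lemma continuous_dlayer t d : continuous (dlayer t d).
Proof.
have c2 (a : R) : continuous (fun s => clampf d (- s - a)).
  move=> s; apply: (@continuous_comp _ _ _ -%R (fun s => clampf d (s - a))).
    exact: opp_continuous.
  exact: continuous_clampf.
move=> s; apply: cvgD; apply: cvgB; solve [exact: continuous_clampf|exact: c2].
Qed.

Lemma dlayer_ge0 t d s : 0 < d -> 0 <= dlayer t d s.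
Proof. by move=> d0; rewrite addr_ge0// subr_ge0; apply: clampf_le => //; lra. Qed.

Definition level t d (j : nat) : R := t + j%:R * d.

Lemma levelS t d j : level t d j.+1 = level t d j + d.
Proof. by rewrite /level -natr1 mulrDl mul1r addrA. Qed.

Lemma level_ge t d j : 0 < d -> t <= level t d j.
Proof. by move=> d0; rewrite lerDl mulr_ge0// ltW. Qed.

(** Each of the two families telescopes to a value at most 1, and since [t >= 0] only one of them
    contributes, according to the sign of [s]. *)
Lemma dlayer_sum t d J s : 0 < d -> 0 <= t -> \sum_(j < J) dlayer (level t d j) d s <= 1.
Proof.
move=> d0 t0.
have E : \sum_(j < J) dlayer (level t d j) d s =
    (clampf d (s - t) - clampf d (s - level t d J)) +
    (clampf d (- s - t) - clampf d (- s - level t d J)).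
  elim: J => [|J IH].
    by rewrite big_ord0 /level mul0r addr0 !subrr addr0.
  by rewrite big_ord_recr /= IH /dlayer levelS; ring.
rewrite E.
have := clampf_ge0 (s - level t d J) d0; have := clampf_ge0 (- s - level t d J) d0.
have := clampf_le1 (s - t) d0; have := clampf_le1 (- s - t) d0.
have [s0|s0] := leP s 0.
  by rewrite (@clampf_eq0 d (s - t))//; lra.
by rewrite (@clampf_eq0 d (- s - t))//; lra.
Qed.

Lemma ramp_sum t d J s : \sum_(j < J) ramp (level t d j) d s =
  softpos d (s - t) - softpos d (s - level t d J).
Proof.
elim: J => [|J IH]; first by rewrite big_ord0 /level mul0r addr0 subrr.
rewrite big_ord_recr /= IH /ramp levelS.
have -> : s - (level t d J + d) = s - level t d J - d by ring.
by ring.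
Qed.

Lemma ramp_sum_bounds t d J s : 0 < d -> 0 <= t -> 0 <= s -> s <= level t d J ->
  s - t - d <= \sum_(j < J) ramp (level t d j) d s <= s.
Proof.
move=> d0 t0 s0 sJ; rewrite ramp_sum.
have /andP[a1 a2] := softpos_bounds (s - t) d0.
have /andP[b1 b2] := softpos_bounds (s - level t d J) d0.
have b3 : softpos d (s - level t d J) = 0.
  by rewrite /softpos /pos2 !max_r ?expr0n/= ?subrr ?mul0r//; lra.
rewrite b3 subr0; apply/andP; split; first lra.
by apply: (le_trans a2); rewrite ge_max s0 andbT; lra.
Qed.

Lemma ramp_sum_le t d J s : 0 < d -> 0 <= t -> 0 <= s ->
  \sum_(j < J) ramp (level t d j) d s <= s.
Proof.
move=> d0 t0 s0; rewrite ramp_sum.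
have /andP[a1 a2] := softpos_bounds (s - t) d0.
have b3 : 0 <= softpos d (s - level t d J).
  rewrite /softpos divr_ge0 ?mulr_ge0 ?(ltW d0)// subr_ge0 /pos2.
  by case: (leP (s - level t d J) 0) => ?; case: (leP (s - level t d J - d) 0) => ?; nra.
have : Num.max (s - t) 0 <= s by rewrite ge_max s0 andbT; lra.
lra.
Qed.

End ramps.

(** * Total variation of finitely many layers *)

Section total_variation.
Context {R : realType} {n : nat}.
Local Notation V := 'rV[R]_n.
Local Notation mu := (lebRn R n).
Local Notation Int f := (mu.-integrable setT (EFin \o f)).
Implicit Types u : Borel V -> R.

Definition test_field (phi : V -> V) := C10_field phi /\ forall x, euclid_norm (phi x) <= 1.

Lemma euclid_norm0 : euclid_norm (0 : V) = 0.
Proof.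
rewrite /euclid_norm big1 ?sqrtr0// => i _.
by rewrite mxE expr0n.
Qed.

Lemma test_field0 : test_field (fun=> 0).
Proof.
split => [|x]; last by rewrite euclid_norm0.
have := @C1_with_C10_field R n 0 (fun _ _ => 0) (fun _ _ _ => 0).
rewrite (_ : (fun x => _) = (fun=> 0)); last first.
  by apply/funext => x; apply/rowP => i; rewrite !mxE.
apply => [i|i x]; last by rewrite eqxx.
split => [|j]; first exact: cst_continuous.
split => [|x]; first exact: cst_continuous.
exact: is_derive_cst.
Qed.

Lemma divRn0 x : divRn (fun=> 0 : V) x = 0.
Proof.
rewrite /divRn big1// => i _; rewrite /partial.
rewrite (_ : (fun _ => _) = cst (0 : R^o)); first exact: derive_cst.
by apply/funext => y; rewrite mxE.
Qed.

Lemma integrable_divRn u phi : Int u -> C10_field phi -> Int (fun x => u x * divRn phi x).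
Proof.
by move=> Iu /divRn_bounded[mdiv [C CP]]; exact: integrable_mul_bounded Iu mdiv CP.
Qed.

Lemma tvRn_ub u phi : Int u -> test_field phi ->
  ((\int[mu]_x (u x * divRn phi x))%:E <= tvRn u)%E.
Proof.
move=> Iu tphi; apply: ereal_sup_ubound; exists phi => //.
rewrite /Rintegral fineK//; apply: integrable_fin_num => //.
by apply: integrable_divRn => //; case: tphi.
Qed.

Lemma tvRn_le u (x : \bar R) : Int u ->
  (forall phi, test_field phi -> ((\int[mu]_x (u x * divRn phi x))%:E <= x)%E) ->
  (tvRn u <= x)%E.
Proof.
move=> Iu H; apply: ge_ereal_sup => _ [phi tphi <-].
apply: le_trans (H phi tphi); rewrite /Rintegral fineK//.
by apply: integrable_fin_num => //; apply: integrable_divRn => //; case: tphi.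
Qed.

Lemma tvRn_ge0 u : Int u -> (0 <= tvRn u)%E.
Proof.
move=> Iu; apply: le_trans (tvRn_ub Iu test_field0).
rewrite lee_fin (_ : Rintegral _ _ _ = 0)//.
under eq_Rintegral do rewrite divRn0 mulr0.
by rewrite Rintegral_cst// mul0r.
Qed.

Lemma tvRnZ u k : 0 <= k -> Int u -> (tvRn u < +oo)%E ->
  (tvRn (fun x => (k * u x)%R) <= k%:E * tvRn u)%E.
Proof.
move=> k0 Iu tu; apply: tvRn_le; first exact: integrable_scale.
move=> phi tphi; under eq_Rintegral do rewrite -mulrA.
rewrite RintegralZl//; last by apply: integrable_divRn => //; case: tphi.
by rewrite EFinM lee_wpmul2l// tvRn_ub.
Qed.

Lemma tvRn_fin u : Int u -> (tvRn u < +oo)%E -> tvRn u \is a fin_num.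
Proof. by move=> Iu tu; rewrite ge0_fin_numE// tvRn_ge0. Qed.

(* A discrete coarea inequality: [u] is cut into the layers between consecutive
   levels [t + j d]. *)
Lemma tvRn_layers u t d J : 0 < d -> 0 <= t -> Int u -> (tvRn u < +oo)%E ->
  [/\ forall j, Int (fun x => layer (level t d j) d (u x)),
      forall j : 'I_J, (tvRn (fun x => layer (level t d j) d (u x)) < +oo)%E
    & (\sum_(j < J) tvRn (fun x => layer (level t d j) d (u x)) <= tvRn u)%E].
Proof.
move=> d0 t0 Iu tu.
pose eta (j : nat) := layer (level t d j) d; pose deta (j : nat) := dlayer (level t d j) d.
have ed (j : nat) s : is_derive s (1 : R) (eta j) (deta j s) by exact: is_derive_layer.
have cd (j : nat) : continuous (deta j) by exact: continuous_dlayer.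
have pd (j : nat) s : 0 <= deta j s by exact: dlayer_ge0.
have sd m s : \sum_(j < m) deta j s <= 1 by exact: dlayer_sum.
have e0 (j : nat) : eta j 0 = 0 by exact: layer0.
(* The index [j] may exceed [J], so the family of the first [j + 1] layers is used, of which this is
   the last. *)
have Ie (j : nat) : Int (fun x => eta j (u x)).
  exact: (@integrable_layer R n j.+1 (fun i : 'I_j.+1 => eta i) (fun i : 'I_j.+1 => deta i) u
    (fun i => ed i) (fun i => pd i) (sd j.+1) Iu (fun i => e0 i) ord_max).
have sum_le (phi : 'I_J -> V -> V) : (forall j, test_field (phi j)) ->
    ((\sum_(j < J) \int[mu]_x (eta j (u x) * divRn (phi j) x))%:E <= tvRn u)%E.
  move=> tphi; apply: (@layers_tv R n J (fun j => eta j) (fun j => deta j)) => //.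
  - by move=> j; case: (tphi j).
  - by move=> j; case: (tphi j).
(* Tested with [phi] on layer [j] and the zero field on the others. Finiteness of each variation
   comes first: near-optimal fields are extracted from a finite supremum. *)
have te (j : 'I_J) : (tvRn (fun x => eta j (u x)) <= tvRn u)%E.
  apply: tvRn_le => // phi tphi.
  have := sum_le (fun i => if i == j then phi else (fun=> 0)).
  rewrite (bigD1 j)//= eqxx big1 ?addr0.
    by apply => i; case: ifP => // _; exact: test_field0.
  move=> i /negbTE ->; under eq_Rintegral do rewrite divRn0 mulr0.
  by rewrite Rintegral_cst// mul0r.
have fe (j : 'I_J) : tvRn (fun x => eta j (u x)) \is a fin_num.
  by apply: tvRn_fin => //; exact: le_lt_trans (te j) tu.
split => //; first by move=> j; exact: le_lt_trans (te j) tu.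
apply/lee_addgt0Pr => e e_gt0.
(* [J.+1] keeps the error positive for [J = 0]; the [J] errors still add up to at most [e]. *)
have eJ : 0 < e / J.+1%:R by rewrite divr_gt0.
have /choice[phi phiP] : forall j : 'I_J, exists phi, test_field phi /\
    (tvRn (fun x => eta j (u x)) <= (\int[mu]_x (eta j (u x) * divRn phi x) + e / J.+1%:R)%:E)%E.
  move=> j; have [_ [phi tphi <-] H] := ub_ereal_sup_adherent eJ (fe j).
  exists phi; split => //.
  have Ip : Int (fun x => eta j (u x) * divRn phi x).
    by apply: integrable_divRn => //; case: tphi.
  rewrite EFinD -leeBlDr//; apply: ltW; apply: lt_le_trans H _.
  by rewrite /Rintegral fineK//; exact: integrable_fin_num.
apply: (@le_trans _ _ (\sum_(j < J) (\int[mu]_x (eta j (u x) * divRn (phi j) x) + e / J.+1%:R)%:E)%E).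
  by apply: lee_sum => j _; case: (phiP j).
rewrite sumEFin big_split /= EFinD; apply: leeD; first by apply: sum_le => j; case: (phiP j).
rewrite sumr_const card_ord -[_ *+ J]mulr_natl lee_fin mulrCA ler_piMr ?(ltW e_gt0)//.
by rewrite ler_pdivrMr// mul1r ler_nat.
Qed.

End total_variation.
(** * From the entropy inequality to the Sobolev inequality on R^n *)

Section entropy_layers.
Context {R : realType} {n : nat}.
Hypothesis n_gt0 : (0 < n)%N.
Local Notation V := 'rV[R]_n.
Local Notation mu := (lebRn R n).
Local Notation Int f := (mu.-integrable setT (EFin \o f)).

Definition entropy_inequality (L : R) := forall u, BVRn u -> L1norm mu u = 1%E ->
  (entropy mu u <= n%:R%:E * lne (L%:E * tvRn u))%E.

Lemma xlnx_ge (t : R) : 0 <= t -> t - 1 <= t * ln t.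
Proof.
rewrite le_eqVlt => /predU1P[<-|t0]; first by rewrite mul0r sub0r lerN10.
have ti : 0 < t^-1 by rewrite invr_gt0.
have : ln (1 + (t^-1 - 1)) <= t^-1 - 1 by apply: le_ln1Dx; lra.
rewrite addrC subrK lnV ?posrE// => H.
have := ler_wpM2l (ltW t0) H; rewrite mulrBr mulfV ?gt_eqF// mulr1; lra.
Qed.

Lemma xlnx_le (t : R) : 0 <= t -> t * ln t <= t * (t - 1).
Proof.
rewrite le_eqVlt => /predU1P[<-|t0]; first by rewrite !mul0r.
have : ln (1 + (t - 1)) <= t - 1 by apply: le_ln1Dx; lra.
by rewrite addrC subrK => H; rewrite ler_pM2l.
Qed.

(** Provides one admissible function of finite entropy. The divergence of the test field is moved
    onto the mollifier by parts, and each component of the field is at most 1. *)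
Lemma moll_BV r : 0 < r -> BVRn (moll r : Borel V -> R).
Proof.
move=> r0; have C1m := @moll_C1 R n r; have sm := @moll_supp R n r (ltW r0).
have Im : Int (moll r) := supp_in_cts_integrable C1m.1 sm.
split => //.
apply: (@le_lt_trans _ _ (\sum_i \int[mu]_x `|dmoll r i x|)%:E); last exact: ltry.
apply: tvRn_le => // phi [C10 phi1]; rewrite lee_fin.
have C1p i := Ck_C1_with (C10.1 i).
have cdp i : continuous (partial i (fun y => phi y 0 i)) by have [_ /(_ i)[]] := C1p i.
have cdm i : continuous (dmoll r i : V -> R) by have [_ /(_ i)[]] := C1m.
have I1 i : Int (fun x => moll r x * partial i (fun y => phi y 0 i) x).
  apply: (@supp_in_cts_integrable _ _ r); first exact: continuous_mulr C1m.1 (cdp i).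
  by move=> x px; apply: sm; apply: contra px => /eqP ->; rewrite mul0r.
have I2 i : Int (fun x => phi x 0 i * dmoll r i x).
  apply: (@supp_in_cts_integrable _ _ r); first exact: continuous_mulr (C1p i).1 (cdm i).
  by move=> x px; apply: (dmoll_supp (ltW r0) (i := i)); apply: contra px => /eqP ->; rewrite mulr0.
have ibp i : \int[mu]_x (moll r x * partial i (fun y => phi y 0 i) x) <= \int[mu]_x `|dmoll r i x|.
  have sF : supp_in r (fun x => moll r x * phi x 0 i).
    by move=> x px; apply: sm; apply: contra px => /eqP ->; rewrite mul0r.
  have := Rintegral_partial0 i (C1_withM C1m (C1p i)) sF.
  rewrite RintegralD// => /eqP; rewrite addr_eq0 => /eqP ->.
  rewrite -mulN1r -RintegralZl//; apply: le_Rintegral => //.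
  - exact: integrable_scale.
  - apply: (@integrable_norm _ _ _ mu setT (dmoll r i)).
    exact: supp_in_cts_integrable (cdm i) (@dmoll_supp R n r i (ltW r0)).
  move=> x _; rewrite mulN1r; apply: le_trans (ler_norm _) _; rewrite normrN normrM ler_piMl//.
  apply: le_trans (phi1 x); rewrite -(ler_pXn2r (_ : (0 < 2)%N)) ?nnegrE ?euclid_norm_ge0//.
  by rewrite real_normK ?num_real// euclid_norm_sq; exact: coord_sqnorm.
apply: le_trans (ler_sum _ (fun i _ => ibp i)); rewrite -Rintegral_sumr//.
by rewrite le_eqVlt; apply/orP; left; apply/eqP; apply: eq_Rintegral => x _; rewrite mulr_sumr.
Qed.

(** For [L <= 0] the right-hand side of the entropy inequality is -oo, whereas a mollifier is
    bounded with bounded support and has finite entropy. *)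
Lemma entropy_constant_gt0 L : entropy_inequality L -> 0 < L.
Proof.
move=> EP; have m0 z : 0 <= (moll 1 z : R) := @moll_ge0 R n 1 z ltr01.
have BV := moll_BV ltr01; have [Im _] := BV.
have m1 : L1norm mu (moll 1 : Borel V -> R) = 1%E.
  rewrite /L1norm Lnorm1 -(@integral_moll R n 1 ltr01).
  by apply: eq_integral => x _ /=; rewrite ger0_norm.
have := EP _ BV m1.
have [C CP] := @moll_bounded R n 1 ler01.
have C0 : 0 <= C by apply: le_trans (CP 0).
have mm : measurable_fun (setT : set (Borel V)) (moll 1) := @measurable_moll R n 1.
have Ie : Int (fun x => `|moll 1 x| * ln `|moll 1 x|).
  apply: (supp_in_integrable (r := 1)).
  - apply: measurable_funM; first exact: measurableT_comp.
    by apply: measurableT_comp; [exact: measurable_ln|exact: measurableT_comp].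
  - exists (1 + C * (C + 1)) => x; set t := `|moll 1 x|.
    have t0 : 0 <= t by exact: normr_ge0.
    have tC : t <= C by exact: CP.
    have := xlnx_ge t0; have := xlnx_le t0; move: (t * ln t) => y; rewrite ler_norml => ? ?.
    by apply/andP; split; nra.
  - move=> x px; apply: (moll_supp ler01); apply: contra px => /eqP ->.
    by rewrite normr0 mul0r.
move=> H; rewrite ltNge; apply/negP => L0.
move: H; rewrite le0_lneNy; last first.
  by apply: mule_le0_ge0; [rewrite lee_fin|exact: tvRn_ge0].
rewrite gt0_muleNy ?lte_fin ?ltr0n// leeNy_eq /entropy => /eqP H.
have := integrable_fin_num measurableT Ie.
by rewrite -[X in X \is a fin_num]/(\int[mu]_x (`|moll 1 x| * ln `|moll 1 x|)%:E)%E H.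
Qed.

(* With [w = |v| / d], the function [b] dominates [- w log w]. The free constant [c]
   makes the bound trivial for layers of small mass [m <= c] and controls
   [m `^ (- 1 / n)] for the others. *)
Lemma entropy_layer L c d (v b : Borel V -> R) : entropy_inequality L -> 0 < c -> 0 < d ->
  Int v -> (tvRn v < +oo)%E -> Int b -> (forall x, `|v x| <= d) -> (forall x, 0 <= b x) ->
  (forall x, [\/ v x = 0, `|v x| = d | 1 <= b x]) ->
  ((d * ((\int[mu]_x (`|v x| / d)) `^ (1 - n%:R^-1) - c `^ (1 - n%:R^-1) -
         c `^ (- n%:R^-1) * \int[mu]_x b x))%:E <= L%:E * tvRn v)%E.
Proof.
move=> EP c0 d0 Iv tv Ib vd b0 vb.
set q : R := n%:R^-1; set m := \int[mu]_x (`|v x| / d).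
have L0 := entropy_constant_gt0 EP.
have q0 : 0 < q by rewrite invr_gt0 ltr0n.
have q1 : q <= 1 by rewrite invf_le1 ?ltr0n// ler1n.
set beta := \int[mu]_x b x.
have beta0 : 0 <= beta by apply: Rintegral_ge0.
have tvf := tvRn_fin Iv tv; have tv0 := tvRn_ge0 Iv.
pose w (x : Borel V) := `|v x| / d.
have w0 x : 0 <= w x by rewrite divr_ge0// ltW.
have w1 x : w x <= 1 by rewrite ler_pdivrMr// mul1r.
have Iw : Int w.
  have := integrable_scale d^-1 (integrable_norm Iv).
  by apply: eq_integrable => // x _ /=; rewrite /w mulrC.
have m0 : 0 <= m by apply: Rintegral_ge0 => x _; exact: w0.
have [mc|cm] := leP m c.
  apply: (@le_trans _ _ 0%E); last by rewrite mule_ge0// lee_fin ltW.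
  rewrite lee_fin pmulr_rle0// subr_le0.
  apply: (@le_trans _ _ 0); last by rewrite mulr_ge0// powR_ge0.
  by rewrite subr_le0 ge0_ler_powR ?nnegrE ?subr_ge0// ltW.
have mp : 0 < m := lt_trans c0 cm.
have dm : 0 < d * m by rewrite mulr_gt0.
pose v1 (x : Borel V) := (d * m)^-1 * v x.
have v1E x : `|v1 x| = m^-1 * w x.
  by rewrite /v1 normrM gtr0_norm ?invr_gt0// invfM /w; ring.
have Iv1 : Int v1 by exact: integrable_scale.
have tv1 : (tvRn v1 <= (d * m)^-1%:E * tvRn v)%E by apply: tvRnZ => //; rewrite invr_ge0 ltW.
have tv1y : (tvRn v1 < +oo)%E.
  by apply: le_lt_trans tv1 _; rewrite -(fineK tvf) -EFinM ltry.
have tv1f := tvRn_fin Iv1 tv1y.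
have N1 : L1norm mu v1 = 1%E.
  rewrite /L1norm Lnorm1.
  transitivity (\int[mu]_x (m^-1 * w x))%:E; last first.
    by rewrite RintegralZl// -/m mulVf ?gt_eqF.
  rewrite /Rintegral fineK; last by apply: integrable_fin_num => //; exact: integrable_scale.
  by apply: eq_integral => x _ /=; rewrite v1E.
(* [w log w] vanishes where [w] is 0 or 1; elsewhere [b >= 1] and [-1 <= w - 1 <= w log w <= 0]. *)
have wlnb x : `|w x * ln (w x)| <= b x.
  have A := xlnx_ge (w0 x); have B := xlnx_le (w0 x).
  have [v0|vE|b1] := vb x.
  - by rewrite /w v0 normr0 mul0r mul0r normr0.
  - by rewrite /w vE divff ?gt_eqF// ln1 mulr0 normr0.
  - have w2 : w x * (w x - 1) <= 0 by rewrite mulr_ge0_le0// subr_le0.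
    rewrite ler_norml (le_trans B (le_trans w2 (b0 x))) andbT.
    by apply: le_trans A; have := w0 x; move: b1; lra.
have mw : measurable_fun setT w by apply/measurable_EFinP; case/integrableP: Iw.
have Iwl : Int (fun x => w x * ln (w x)).
  apply: (@le_integrable _ _ _ _ _ measurableT _ (EFin \o b)) => //.
    apply/measurable_EFinP; apply: measurable_funM => //.
    by apply: measurableT_comp => //; exact: measurable_ln.
  by move=> x _ /=; rewrite lee_fin (le_trans (wlnb x))// ler_norm.
set E := \int[mu]_x (w x * ln (w x)).
have EB : - beta <= E.
  rewrite /beta -mulN1r -RintegralZl//; apply: le_Rintegral => //; first exact: integrable_scale.
  by move=> x _; have := wlnb x; rewrite ler_norml mulN1r => /andP[].
have entE : entropy mu v1 = (E / m - ln m)%:E.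
  transitivity (\int[mu]_x (m^-1 * (w x * ln (w x)) + (- (m^-1 * ln m)) * w x))%:E; last first.
    rewrite RintegralD//; [|exact: integrable_scale|exact: integrable_scale].
    rewrite !RintegralZl// -/m -/E; congr EFin; field.
    by rewrite gt_eqF.
  rewrite /Rintegral fineK; last first.
    by apply: integrable_fin_num => //; apply: integrable_add; exact: integrable_scale.
  apply: eq_integral => x _; rewrite v1E; congr EFin.
  have := w0 x; rewrite le_eqVlt => /predU1P[<-|wp]; first by rewrite !(mulr0, mul0r) addr0.
  by rewrite lnM ?posrE ?invr_gt0// lnV ?posrE//; ring.
have := EP v1 (conj Iv1 tv1y) N1; rewrite entE.
move: tv1; rewrite -(fineK tv1f) -(fineK tvf) -!EFinM lee_fin.
set T1 := fine (tvRn v1); set T := fine (tvRn v) => T1T.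
(* A nonpositive argument would make the right-hand side -oo, although the entropy of [v1] is
   finite. *)
have [LT|LT] := leP (L * T1) 0.
  by rewrite le0_lneNy ?lee_fin// gt0_muleNy ?lte_fin ?ltr0n.
rewrite lne_EFin// -EFinM !lee_fin => H.
(* The exponential of the entropy inequality reads [m^(-1/n) exp (E / (n m)) <= L T1]; then use
   [exp x >= 1 + x] and [E >= - beta]. *)
have X : m `^ (- q) * (1 - q * beta / m) <= L * T1.
  rewrite -[leRHS]lnK ?posrE//.
  apply: (@le_trans _ _ (expR (q * (E / m - ln m)))).
    have -> : q * (E / m - ln m) = - q * ln m + q * (E / m) by ring.
    rewrite expRD /powR gt_eqF// ler_wpM2l ?expR_ge0//.
    apply: le_trans (expR_ge1Dx _); rewrite lerD2l -mulrA -mulrN ler_wpM2l ?(ltW q0)//.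
    by rewrite -mulNr ler_wpM2r// invr_ge0.
  rewrite ler_expR -(ler_pM2l (_ : 0 < n%:R)) ?ltr0n//.
  by rewrite mulrA /q mulfV ?mul1r// pnatr_eq0 -lt0n.
have Y : d * m * (L * T1) <= L * T.
  move: T1T; rewrite -(ler_pM2l (mulr_gt0 L0 dm)) => T1T.
  apply: le_trans (_ : L * (d * m) * T1 <= _); first by rewrite le_eqVlt; apply/orP; left; apply/eqP; ring.
  by apply: (le_trans T1T); rewrite -mulrA (mulVKf (lt0r_neq0 dm)).
apply: le_trans Y; rewrite -mulrA ler_wpM2l ?(ltW d0)//.
apply: le_trans (_ : m * (m `^ (- q) * (1 - q * beta / m)) <= _); last by rewrite ler_pM2l.
have mE : m * m `^ (- q) = m `^ (1 - q).
  have mn0 : m != 0 by rewrite gt_eqF.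
  by rewrite powRD ?mn0 ?implybT// powRr1 ?(ltW mp).
rewrite mulrA mE mulrBr mulr1.
have -> : m `^ (1 - q) * (q * beta / m) = m `^ (- q) * (q * beta).
  by rewrite -mE; field; rewrite gt_eqF.
have cmq : m `^ (- q) <= c `^ (- q).
  rewrite !powRN lef_pV2 ?posrE ?powR_gt0//.
  by rewrite ge0_ler_powR ?nnegrE// ?ltW.
have P1 := powR_ge0 m (- q); have P2 := powR_ge0 c (1 - q).
have qb : q * beta <= beta by rewrite ler_piMl.
have qb0 : 0 <= q * beta by rewrite mulr_ge0// ltW.
have : m `^ (- q) * (q * beta) <= c `^ (- q) * beta by exact: ler_pM.
lra.
Qed.

End entropy_layers.

(** * The norm of exponent n / (n - 1) *)

Section Lstar.
Context d (T : measurableType d) {R : realType} (m : {measure set T -> \bar R}).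
Context {n : nat}.
Hypothesis n_ge2 : (2 <= n)%N.
Implicit Types f g : T -> R.
Local Notation p := (n%:R / (n%:R - 1) : R).

Lemma n1_gt0 : 0 < n%:R - 1 :> R.
Proof. by rewrite subr_gt0 ltr1n. Qed.

Lemma pstar_ge1 : 1 <= p.
Proof. by rewrite ler_pdivlMr ?n1_gt0// mul1r lerBlDl lerDr. Qed.

Lemma pstar_gt0 : 0 < p. Proof. exact: lt_le_trans ltr01 pstar_ge1. Qed.

Lemma pstarV : p^-1 = 1 - n%:R^-1.
Proof.
rewrite invf_div mulrBl mul1r divff// pnatr_eq0 -lt0n.
exact: leq_trans n_ge2.
Qed.

Lemma LstarE f : (Lstarnorm m n f = (\int[m]_x (`|f x| `^ p)%:E) `^ p^-1)%E.
Proof. by rewrite /Lstarnorm unlock. Qed.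

Lemma Lstar_leP f y : 0 <= y ->
  (Lstarnorm m n f <= y%:E)%E <-> (\int[m]_x (`|f x| `^ p)%:E <= (y `^ p)%:E)%E.
Proof.
move=> y0; rewrite LstarE; set I := (\int[m]_x _)%E.
have I0 : (0 <= I)%E by apply: integral_ge0 => x _; rewrite lee_fin powR_ge0.
have p0 := pstar_gt0.
split => H.
  have := gt0_ler_poweR (ltW p0) _ _ H.
  rewrite !in_itv/= !leey !poweR_ge0 lee_fin y0 => /(_ isT isT).
  by rewrite -poweRrM mulVf ?gt_eqF// poweRe1// poweR_EFin.
have pv : 0 <= p^-1 by rewrite invr_ge0 ltW.
have := gt0_ler_poweR pv _ _ H.
rewrite !in_itv/= !leey I0 lee_fin powR_ge0 => /(_ isT isT).
by rewrite ?poweR_EFin -powRrM mulfV ?gt_eqF// powRr1.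
Qed.

Lemma Lstar_norm f : (Lstarnorm m n (fun x => `|f x|%R) = Lstarnorm m n f)%E.
Proof. by rewrite !LstarE; under eq_integral do rewrite normr_id. Qed.

Lemma Lstar_sum (s : seq nat) (F : nat -> T -> R) : (forall j, measurable_fun setT (F j)) ->
  (Lstarnorm m n (fun x => (\sum_(j <- s) F j x)%R) <= \sum_(j <- s) Lstarnorm m n (F j))%E.
Proof.
move=> mF; elim: s => [|j s IH].
  rewrite LstarE (_ : integral _ _ _ = 0%E).
    by rewrite poweR0r ?big_nil// invr_neq0// gt_eqF// pstar_gt0.
  by apply: integral0_eq => x _; rewrite big_nil normr0 powR0// gt_eqF// pstar_gt0.
rewrite (_ : (fun x => _) = (F j \+ (fun x => (\sum_(j <- s) F j x)%R))); last first.
  by apply/funext => x; rewrite big_cons.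
rewrite big_cons; apply: le_trans (leeD2l _ IH).
apply: eminkowski => //; last by rewrite lee_fin pstar_ge1.
exact: measurable_sum.
Qed.

(** For [w = |f| / e] in the unit interval and [p >= 1] one has [w^p <= w]. The estimate is an
    equality on multiples of indicators taking the value [e], which is why nothing is lost in the
    limit of thin layers. *)
Lemma Lstar_bounded f e : 0 < e -> m.-integrable setT (EFin \o f) -> (forall x, `|f x| <= e) ->
  (Lstarnorm m n f <= (e * (\int[m]_x (`|f x| / e)) `^ (1 - n%:R^-1))%:E)%E.
Proof.
move=> e0 If fe; rewrite -pstarV.
have p0 := pstar_gt0.
have mf : measurable_fun setT f by apply/measurable_EFinP; case/integrableP: If.
have Iw : m.-integrable setT (EFin \o (fun x => `|f x| / e)).
  have := integrable_scale e^-1 (integrable_norm If).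
  by apply: eq_integrable => // x _ /=; rewrite mulrC.
have W0 : 0 <= \int[m]_x (`|f x| / e).
  by apply: Rintegral_ge0 => x _; rewrite divr_ge0// ltW.
apply/Lstar_leP; first by rewrite mulr_ge0 ?(ltW e0)// powR_ge0.
rewrite powRM ?(ltW e0) ?powR_ge0// -powRrM mulVf ?gt_eqF// powRr1//.
rewrite -RintegralZl// /Rintegral fineK; last first.
  by apply: integrable_fin_num => //; exact: integrable_scale.
apply: ge0_le_integral => //.
- apply/measurable_EFinP; apply: (measurableT_comp (measurable_powR _)).
  exact: measurableT_comp.
- apply/measurable_EFinP; apply: measurable_funM => //.
  by apply: measurable_funM => //; exact: measurableT_comp.
move=> x _; rewrite lee_fin.
have [fx0|fx] := eqVneq (f x) 0.
  by rewrite fx0 normr0 powR0 ?gt_eqF// mul0r mulr0.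
rewrite [X in X `^ _ <= _](_ : _ = e * (`|f x| / e)); last by field; rewrite gt_eqF.
have w0 : 0 < `|f x| / e by rewrite divr_gt0// normr_gt0.
rewrite powRM ?(ltW w0) ?(ltW e0)// ler_wpM2l ?powR_ge0//.
apply: ge1r_powR; last exact: pstar_ge1.
by rewrite w0 ler_pdivrMr// mul1r fe.
Qed.

Lemma Lstar_fatou f (g : nat -> T -> R) y : 0 <= y -> measurable_fun setT f ->
  (forall k, measurable_fun setT (g k)) -> (forall x, g ^~ x @ \oo --> `|f x|) ->
  (forall k x, 0 <= g k x <= `|f x|) ->
  (forall k, Lstarnorm m n (g k) <= y%:E)%E -> (Lstarnorm m n f <= y%:E)%E.
Proof.
move=> y0 mf mg gf g0 gy; apply/Lstar_leP => //.
have p0 := pstar_gt0.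
have gE k x : `|g k x| = g k x by rewrite ger0_norm//; have /andP[] := g0 k x.
have mgp k : measurable_fun setT (fun x => (`|g k x| `^ p)%:E).
  apply/measurable_EFinP; apply: (measurableT_comp (measurable_powR _)).
  exact: measurableT_comp.
have := @fatou _ _ _ m setT measurableT (fun k x => (`|g k x| `^ p)%:E) mgp _.
move=> /(_ (fun k x _ => powR_ge0 _ _)) H.
rewrite (eq_integral (fun x => limn_einf ((fun k x => (`|g k x| `^ p)%:E) ^~ x))); last first.
  move=> x _; apply/esym.
  have cv0 : `|g k x| `^ p @[k --> \oo] --> `|f x| `^ p.
    (* Continuity of the power is drawn from its differentiability at positive reals; at a zero of
       [f] the bounds on [g] force [g k x = 0]. *)
    have [fx0|fx] := eqVneq `|f x| 0.
      rewrite (_ : (fun k => `|g k x| `^ p) = (fun=> `|f x| `^ p)); first exact: cvg_cst.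
      apply/funext => k /=; have /andP[g1 g2] := g0 k x; congr (_ `^ _).
      by rewrite fx0; apply/eqP; rewrite normr_eq0 eq_le g1 -fx0 g2.
    have fp : 0 < `|f x| by rewrite lt_neqAle eq_sym fx normr_ge0.
    under eq_fun do rewrite gE.
    have cp : {for `|f x|, continuous (fun z : R => z `^ p)}.
      apply/differentiable_continuous/derivable1_diffP.
      by apply: derivable_powR; rewrite in_itv/= fp.
    exact: (cvg_comp (g ^~ x) (fun z : R => z `^ p) (gf x) cp).
  have cv : (`|g k x| `^ p)%:E @[k --> \oo] --> (`|f x| `^ p)%:E.
    by apply: cvg_EFin; [exact: nearW|exact: cv0].
  by rewrite is_cvg_limn_einfE; [exact/cvg_lim|apply/cvg_ex; exists (`|f x| `^ p)%:E].
apply: (le_trans H).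
have -> : (y `^ p)%:E = limn_einf (fun=> (y `^ p)%:E).
  have cc : (fun=> (y `^ p)%:E) @ \oo --> (y `^ p)%:E by exact: cvg_cst.
  by rewrite is_cvg_limn_einfE; [exact/esym/cvg_lim|apply/cvg_ex; exists (y `^ p)%:E].
rewrite !limn_einf_lim; apply: lee_lim; [exact: is_cvg_einfs|exact: is_cvg_einfs|].
apply: nearW => k; apply: le_ereal_inf_tmp => _ [j kj <-].
apply: ge_ereal_inf; exists (\int[m]_x (`|g j x| `^ p)%:E)%E; first by exists j.
exact/Lstar_leP.
Qed.

End Lstar.

(** * Summation over the layers and passage to the limit *)

Section sobolev_from_entropy.
Context {R : realType} {n : nat}.
Hypothesis n_ge2 : (2 <= n)%N.
Local Notation V := 'rV[R]_n.
Local Notation mu := (lebRn R n).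
Local Notation Int f := (mu.-integrable setT (EFin \o f)).

Let n_gt0 : (0 < n)%N. Proof. exact: leq_trans n_ge2. Qed.

(** Markov's inequality in pointwise form: the indicator is at most [|u| / s]. *)
Lemma integrable_superlevel (u : Borel V -> R) s : 0 < s -> Int u ->
  Int (\1_[set x | s < `|u x|]).
Proof.
move=> s0 Iu; have mu_ : measurable_fun setT u by apply/measurable_EFinP; case/integrableP: Iu.
have mS : measurable [set x : Borel V | s < `|u x|].
  have mn : measurable_fun setT (fun x : Borel V => `|u x|) by exact: measurableT_comp.
  rewrite (_ : [set x | _] = setT `&` (fun x : Borel V => `|u x|) @^-1` `]s, +oo[%classic).
    by apply: mn => //; exact: measurable_itv.
  by apply/seteqP; split => x /=; rewrite in_itv/= andbT; [split|case].
apply: (@le_integrable _ _ _ _ _ measurableT _ (EFin \o (fun x => s^-1 * u x))).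
- by apply/measurable_EFinP; exact: measurable_indic.
- move=> x _ /=; rewrite lee_fin indicE normrM (gtr0_norm (_ : 0 < s^-1)) ?invr_gt0//.
  have [sx|sx] := pselect (s < `|u x|).
    by rewrite mem_set// normr1 mulrC ler_pdivlMr// mul1r ltW.
  by rewrite memNset// normr0 mulr_ge0// invr_ge0 ltW.
- exact: integrable_scale.
Qed.

(** [g] is the sum of the absolute values of layers of [u] that start at level [t = 1 / (k + 1)] and
    fill a height [T = k + 1]. Since [t > 0], the superlevel sets involved have finite measure. The
    loss [2 t] is made of the lowest level and of one layer height [d <= t]. *)
Lemma truncation_Lstar (L : R) (u : Borel V -> R) e k : entropy_inequality (n := n) L ->
  BVRn u -> 0 < e ->
  exists g : Borel V -> R, [/\ measurable_fun setT g, forall x, 0 <= g x <= `|u x|,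
    forall x, `|u x| <= k.+1%:R -> `|u x| - 2 * k.+1%:R^-1 <= g x &
    (Lstarnorm mu n g <= (L * fine (tvRn u) + e)%:E)%E].
Proof.
move=> EP [Iu tu] e0; have L0 := entropy_constant_gt0 n_gt0 EP.
have mu_ : measurable_fun setT u by apply/measurable_EFinP; case/integrableP: Iu.
pose q' : R := 1 - n%:R^-1.
have q'0 : 0 < q' by rewrite subr_gt0 invf_lt1 ?ltr0n// ltr1n.
pose t : R := k.+1%:R^-1; pose T : R := k.+1%:R.
have t0 : 0 < t by rewrite invr_gt0.
have T0 : 0 < T by rewrite ltr0n.
pose ind (s : R) : Borel V -> R := \1_[set x | s < `|u x|].
pose A s := \int[mu]_x ind s x.
have Iind s : t <= s -> Int (ind s).
  by move=> ts; apply: integrable_superlevel => //; exact: lt_le_trans ts.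
have ind_le s s' x : s <= s' -> ind s' x <= ind s x.
  move=> ss; rewrite /ind !indicE ler_nat.
  have [h|h] := pselect (s' < `|u x|); last by rewrite [X in (nat_of_bool X <= _)%N]memNset.
  by rewrite !mem_set//=; exact: le_lt_trans h.
have A0 s : 0 <= A s by apply: Rintegral_ge0 => x _; rewrite /ind indicE.
(* The terms [d c^(1-1/n)] of the [J] layers add up to [T c^(1-1/n) = e / 2], because [J d = T]. *)
pose c : R := (e / (2 * T)) `^ q'^-1.
have eT : 0 < e / (2 * T) by rewrite divr_gt0// mulr_gt0.
have c0 : 0 < c by rewrite powR_gt0.
have cq : c `^ q' = e / (2 * T) by rewrite /c -powRrM mulVf ?gt_eqF// powRr1// ltW.
pose K := c `^ (- n%:R^-1) * A t.
have K0 : 0 <= K by rewrite mulr_ge0// powR_ge0.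
(* [d <= t] bounds the pointwise loss [t + d] by [2 t]; the other bound keeps the entropy defects,
   in total at most [2 d K], below [e / 2]. The added 1 covers [K = 0]. *)
pose delta := Num.min t (e / (4 * K + 1)).
have delta0 : 0 < delta by rewrite lt_min t0 divr_gt0// ltr_wpDl// mulr_ge0.
(* The successor keeps [J] positive, so that [d = T / J] makes the layers fill the height [T]
   exactly. *)
pose J := (Num.bound (T / delta)).+1.
pose d := T / J%:R.
have d0 : 0 < d by rewrite divr_gt0.
have dd : d <= delta.
  rewrite ler_pdivrMr// mulrC -ler_pdivrMr//; apply: ltW.
  apply: lt_trans (archi_boundP _) _; first by rewrite divr_ge0// ltW.
  by rewrite ltr_nat.
have Jd : J%:R * d = T by rewrite mulrC divfK// pnatr_eq0.
pose v (j : nat) (x : Borel V) := layer (level t d j) d (u x).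
have [Iv tv tvs] := tvRn_layers J d0 (ltW t0) Iu tu.
have lt0 j : 0 <= level t d j by apply: le_trans (level_ge t j d0); exact: ltW.
have vE j x : `|v j x| = ramp (level t d j) d `|u x| by exact: norm_layer.
have vd j x : `|v j x| <= d by rewrite vE; case/andP: (ramp_bounds (level t d j) `|u x| d0).
(* The indicator of the zone where [|u|] lies above level [j] and at most at level [j + 2]. Off this
   zone the layer is 0 or has reached [d]; the index [j + 2] reflects the width [2 d] of a ramp. *)
pose b (j : nat) (x : Borel V) := ind (level t d j) x - ind (level t d j.+2) x.
have Ib j : Int (b j).
  by apply: integrable_sub; apply: Iind; exact: level_ge.
have levelSS j : level t d j.+2 = level t d j + d + d by rewrite !levelS.
have b0 j x : 0 <= b j x.
  by rewrite subr_ge0; apply: ind_le; rewrite levelSS; lra.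
have vb j x : [\/ v j x = 0, `|v j x| = d | 1 <= b j x].
  have [h1|h1] := leP `|u x| (level t d j).
    by apply: Or31; apply/eqP; rewrite -normr_eq0 vE ramp_eq0.
  have [h2|h2] := leP (level t d j + d + d) `|u x|.
    by apply: Or32; rewrite vE ramp_eqd.
  apply: Or33; rewrite /b /ind !indicE mem_set//= memNset ?subr0//=.
  by apply/negP; rewrite -leNgt levelSS ltW.
have intb j : \int[mu]_x b j x = A (level t d j) - A (level t d j.+2).
  by rewrite RintegralB//; apply: Iind; exact: level_ge.
(* The sum telescopes with stride 2: each point lies in at most two of the zones, whence the factor
   2. *)
have sumb : \sum_(j < J) \int[mu]_x b j x <= 2 * A t.
  have E m : \sum_(j < m) \int[mu]_x b j x =
      A (level t d 0) + A (level t d 1) - A (level t d m) - A (level t d m.+1).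
    elim: m => [|m IH]; first by rewrite big_ord0; ring.
    by rewrite big_ord_recr /= IH intb; ring.
  rewrite E.
  have A1 : A (level t d 1) <= A (level t d 0).
    apply: le_Rintegral => //; try by apply: Iind; exact: level_ge.
    by move=> x _; apply: ind_le; rewrite levelS; lra.
  have := A0 (level t d J); have := A0 (level t d J.+1).
  have lev0 : level t d 0 = t by rewrite /level mul0r addr0.
  by move: A1; rewrite lev0; lra.
have tvf := tvRn_fin Iu tu.
have tvjf j : (j < J)%N -> tvRn (v j) \is a fin_num.
  by move=> jJ; exact: tvRn_fin (Iv j) (tv (Ordinal jJ)).
(* The entropy bound on the variation of the layer is solved for the power of its mass, which
   dominates the norm by [Lstar_bounded]. *)
have Lv j : (j < J)%N ->
    (Lstarnorm mu n (v j) <= (L * fine (tvRn (v j)) + d * (c `^ q' + c `^ (- n%:R^-1) * \int[mu]_x b j x))%:E)%E.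
  move=> jJ; apply: le_trans (Lstar_bounded n_ge2 d0 (Iv j) (vd j)) _.
  have := entropy_layer n_gt0 EP c0 d0 (Iv j) (tv (Ordinal jJ)) (Ib j) (vd j) (b0 j) (vb j).
  rewrite -(fineK (tvjf _ jJ)) -EFinM !lee_fin -/q' => H; rewrite -/(v j); move: H.
  rewrite !mulrDr !mulrN; lra.
pose g (x : Borel V) := \sum_(0 <= j < J) `|v j x|.
have gE x : g x = \sum_(j < J) ramp (level t d j) d `|u x|.
  by rewrite /g big_mkord; apply: eq_bigr => j _; rewrite vE.
have mv j : measurable_fun setT (v j) by apply/measurable_EFinP; case/integrableP: (Iv j).
exists g; split.
- by apply: measurable_sum => j; exact: measurableT_comp.
- move=> x; rewrite gE ramp_sum_le ?(ltW t0)// andbT sumr_ge0// => j _.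
  by case/andP: (ramp_bounds (level t d j) `|u x| d0).
- move=> x ux.
  have uJ : `|u x| <= level t d J by rewrite /level Jd (le_trans ux)// lerDr ltW.
  have /andP[+ _] := ramp_sum_bounds d0 (ltW t0) (normr_ge0 (u x)) uJ.
  rewrite -gE; have : d <= t by apply: le_trans dd _; rewrite ge_min lexx.
  by rewrite -/t; lra.
apply: (@le_trans _ _ (\sum_(0 <= j < J) Lstarnorm mu n (v j))%E).
  have := @Lstar_sum _ _ _ mu n n_ge2 (index_iota 0 J) (fun j x => `|v j x|).
  move=> /(_ (fun j => measurableT_comp _ (mv j))) H.
  apply: le_trans (H _) _ => //.
  by apply: lee_sum => j _; rewrite Lstar_norm.
rewrite big_mkord.
apply: (@le_trans _ _ (\sum_(j < J) (L * fine (tvRn (v j)) + d * (c `^ q' + c `^ (- n%:R^-1) * \int[mu]_x b j x))%:E)%E).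
  by apply: lee_sum => j _; exact: Lv.
rewrite sumEFin lee_fin big_split /= -!mulr_sumr big_split /= -mulr_sumr.
apply: lerD.
  rewrite ler_pM2l// -lee_fin -sumEFin (fineK tvf); apply: le_trans tvs.
  by apply: lee_sum => j _; rewrite fineK ?tvjf.
rewrite sumr_const card_ord mulrDr.
have h1 : d * (c `^ q' *+ J) = e / 2.
  rewrite -[_ *+ J]mulr_natl mulrA [d * _]mulrC Jd cq.
  by field; rewrite gt_eqF.
have h2 : d * (c `^ (- n%:R^-1) * \sum_(j < J) \int[mu]_x b j x) <= d * (2 * K).
  rewrite ler_pM2l// /K mulrCA ler_wpM2l ?powR_ge0//.
have h3 : d * (2 * K) <= e / 2.
  have : d <= e / (4 * K + 1) by apply: le_trans dd _; rewrite ge_min lexx orbT.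
  have K40 : 0 < 4 * K + 1 by rewrite ltr_wpDl// mulr_ge0.
  by rewrite ler_pdivlMr// => h; have := ltW d0; lra.
by rewrite h1; lra.
Qed.

(** For fixed [e] the truncations converge pointwise to [|u|] as [k] grows, with a bound on their
    norms that does not depend on [k]; Fatou's lemma applies, and [e] is arbitrary. *)
Lemma sobolev_of_entropy (L : R) (u : Borel V -> R) : entropy_inequality (n := n) L ->
  BVRn u -> (Lstarnorm mu n u <= L%:E * tvRn u)%E.
Proof.
move=> EP BVu; have [Iu tu] := BVu; have L0 := entropy_constant_gt0 n_gt0 EP.
have tvf := tvRn_fin Iu tu.
have mu_ : measurable_fun setT u by apply/measurable_EFinP; case/integrableP: Iu.
rewrite -(fineK tvf) -EFinM; apply/lee_addgt0Pr => e e0.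
have /choice[g gP] := fun k => @truncation_Lstar L u e k EP BVu e0.
have X0 : 0 <= L * fine (tvRn u) by rewrite mulr_ge0 ?(ltW L0)// fine_ge0// tvRn_ge0.
rewrite -EFinD; apply: (@Lstar_fatou _ _ _ _ _ n_ge2 u g); rewrite ?addr_ge0 ?(ltW e0)//.
- by move=> k; case: (gP k).
- move=> x; apply/cvgrPdist_le => /= eps eps0.
  have e20 : 0 < eps / 2 by rewrite divr_gt0.
  near=> k; have [_ /(_ x)/andP[_ g1] g2 _] := gP k.
  rewrite ger0_norm ?subr_ge0//.
  have ux : `|u x| <= k.+1%:R.
    apply: (@le_trans _ _ k%:R); last by rewrite ler_nat.
    by near: k; exact: nbhs_infty_ger.
  have hk : k.+1%:R^-1 < eps / 2.
    by near: k; exact: (near_infty_natSinv_lt (PosNum e20)).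
  move: hk (g2 _ ux); set t := _^-1; move: t (g k x) => t gx hk h.
  by rewrite lerBlDr; lra.
- by move=> k x; case: (gP k).
- by move=> k; case: (gP k).
Unshelve. all: by end_near. Qed.

Lemma K1_le_entropy_constant (L : R) : entropy_inequality (n := n) L -> K1 R n <= L.
Proof.
move=> EP; have L0 := entropy_constant_gt0 n_gt0 EP.
rewrite /K1; set I := ereal_inf _.
have LI : (L^-1%:E <= I)%E.
  apply: le_ereal_inf_tmp => _ [u [BVu u1] <-].
  have := sobolev_of_entropy EP BVu; rewrite u1.
  have [Iu tu] := BVu; rewrite -(fineK (tvRn_fin Iu tu)) -EFinM !lee_fin => h.
  by rewrite -(ler_pM2l L0) mulfV// gt_eqF.
(* If the infimum is +oo, [fine] turns it into 0 and [K1] becomes [0^-1 = 0], which is below [L];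
   the value -oo is excluded by the lower bound. *)
case: I LI => [r| |]; [|by move=> _; rewrite /= invr0 ltW|by []].
rewrite lee_fin /= => Lr.
have Li0 : 0 < L^-1 by rewrite invr_gt0.
by rewrite -[leRHS]invrK lef_pV2// posrE// (lt_le_trans Li0).
Qed.

End sobolev_from_entropy.
(** * The manifold *)

Section jensen.
Context d (T : measurableType d) {R : realType} (m : {measure set T -> \bar R}).
Context {n : nat}.
Hypothesis n_ge2 : (2 <= n)%N.
Local Notation p := (n%:R / (n%:R - 1) : R).

(** Made for [f = |u| log |u|] on a general measure space, where the negative part may have infinite
    integral. In that case the integral of [f] is -oo, the positive part being controlled by [|g|];
    otherwise [f] is integrable. *)
Lemma le_integral_integrable (f g : T -> \bar R) : measurable_fun setT f ->
  m.-integrable setT g -> (forall x, (f x <= g x)%E) ->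
  (\int[m]_x f x <= \int[m]_x g x)%E.
Proof.
move=> mf Ig fg.
have [fny|fny] := eqVneq (\int[m]_x f^\- x)%E +oo%E.
  have Ify : (\int[m]_x f^\+ x < +oo)%E.
    have /integrableP[mg gy] := Ig.
    apply: le_lt_trans gy; apply: ge0_le_integral => //.
    - exact: measurable_funepos.
    - exact: measurableT_comp.
    move=> x _; rewrite funeposE ge_max abse_ge0 andbT.
    by apply: le_trans (fg x) _; exact: lee_abs.
  rewrite integralE fny.
  have Ip0 : (0 <= \int[m]_x f^\+ x)%E by exact: integral_ge0.
  have Ipf : (\int[m]_x f^\+ x)%E \is a fin_num by rewrite ge0_fin_numE.
  by rewrite -(fineK Ipf) /= leNye.
apply: le_integral => //.
apply/integrableP; split => //.
under eq_integral do rewrite -/((abse \o f) _) fune_abse.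
rewrite ge0_integralD//; [|exact: measurable_funepos|exact: measurable_funeneg].
have /integrableP[mg gy] := Ig.
apply: lte_add_pinfty; last by rewrite ltey.
apply: le_lt_trans gy; apply: ge0_le_integral => //.
- exact: measurable_funepos.
- exact: measurableT_comp.
move=> x _; rewrite funeposE ge_max abse_ge0 andbT.
by apply: le_trans (fg x) _; exact: lee_abs.
Qed.

(* Jensen's inequality, through [log y <= y - 1] at [y = |u|^(1/(n-1)) / N^p]. *)
Lemma entropy_le_Lstar (u : T -> R) N : m.-integrable setT (EFin \o u) ->
  L1norm m u = 1%E -> 0 < N -> Lstarnorm m n u = N%:E ->
  (entropy m u <= (n%:R * ln N)%:E)%E.
Proof.
move=> Iu u1 N0 uN.
have mu_ : measurable_fun setT u by apply/measurable_EFinP; case/integrableP: Iu.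
have n0 : (0 < n)%N by exact: leq_trans n_ge2.
have n10 := n1_gt0 (R := R) n_ge2.
have p0 : 0 < p := pstar_gt0 (R := R) n_ge2.
have IP : (\int[m]_x (`|u x| `^ p)%:E = (N `^ p)%:E)%E.
  have := LstarE m (n := n) u; rewrite uN => /(congr1 (fun x => x `^ p)%E).
  by rewrite poweR_EFin -poweRrM mulVf ?gt_eqF// poweRe1// integral_ge0// => x _; rewrite lee_fin powR_ge0.
have mup : measurable_fun setT (fun x => `|u x| `^ p).
  by apply: (measurableT_comp (measurable_powR _)); exact: measurableT_comp.
have Iup : m.-integrable setT (EFin \o (fun x => `|u x| `^ p)).
  apply/integrableP; split; first exact/measurable_EFinP.
  rewrite (eq_integral (fun x => (`|u x| `^ p)%:E)); last first.
    by move=> x _ /=; rewrite ger0_norm// powR_ge0.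
  by rewrite IP ltry.
have Inu := integrable_norm Iu.
pose Z := N `^ p; have Z0 : 0 < Z by rewrite powR_gt0.
pose s : R := n%:R - 1.
(* The bound [log y <= y - 1] multiplied by [(n - 1) |u|]. As [|u|] has integral 1 and its power [p]
   has integral [Z], the terms without logarithm cancel, and [(n - 1) log Z = n log N] remains. *)
pose G x := (s * Z^-1) * (`|u x| `^ p) + (s * (ln Z - 1)) * `|u x|.
have IG : m.-integrable setT (EFin \o G).
  by apply: (integrableD measurableT (integrable_scale _ Iup) (integrable_scale _ Inu)).
have uG x : `|u x| * ln `|u x| <= G x.
  rewrite /G; have := normr_ge0 (u x); set t := `|u x|.
  rewrite le_eqVlt => /predU1P[<-|t0].
    by rewrite powR0 ?gt_eqF// !(mulr0, mul0r) addr0.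
  set y := t `^ s^-1 / Z.
  have ts0 : 0 < t `^ s^-1 by rewrite powR_gt0.
  have y0 : 0 < y by rewrite divr_gt0.
  have : ln (1 + (y - 1)) <= y - 1 by apply: le_ln1Dx; lra.
  rewrite addrC subrK ln_div ?posrE// ln_powR => H.
  have tp : t `^ p = t * t `^ s^-1.
    have -> : p = 1 + s^-1 by rewrite /s; field; rewrite gt_eqF.
    by rewrite powRD ?(gt_eqF t0) ?implybT// powRr1// ltW.
  rewrite tp; have := ler_wpM2l (ltW (mulr_gt0 t0 n10)) H.
  rewrite -/s /y.
  have -> : t * s * (s^-1 * ln t - ln Z) = t * ln t - t * s * ln Z.
    by field; rewrite gt_eqF.
  rewrite lerBlDr => /le_trans; apply; rewrite le_eqVlt; apply/orP; left; apply/eqP.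
  by field; rewrite gt_eqF.
have mf : measurable_fun setT (fun x => (`|u x| * ln `|u x|)%:E).
  apply/measurable_EFinP; apply: measurable_funM; first exact: measurableT_comp.
  by apply: measurableT_comp; [exact: measurable_ln|exact: measurableT_comp].
apply: le_trans (le_integral_integrable mf IG (fun x => uG x)) _.
have RG : \int[m]_x G x = n%:R * ln N.
  rewrite /G RintegralD//; [|exact: integrable_scale|exact: integrable_scale].
  rewrite !RintegralZl//.
  have -> : \int[m]_x `|u x| `^ p = Z by rewrite /Rintegral IP.
  have -> : \int[m]_x `|u x| = 1 by move: u1; rewrite /L1norm Lnorm1 /Rintegral => ->.
  rewrite /Z ln_powR mulr1 -mulrA mulVf ?gt_eqF// /s; field.
  by rewrite gt_eqF.
by rewrite -RG /Rintegral fineK//; exact: integrable_fin_num.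
Qed.

End jensen.

Section total_variation_manifold.
Context (R : realType) (n : nat) (M : ptopologicalType).
Context (A : smooth_atlas R n M) (g : riemannian_metric A).
Variable vol : {measure set (Borel M) -> \bar R}.

Lemma Ck_on_cst k (U : set 'rV[R]_n) (c : R^o) : Ck_on k U (cst c).
Proof.
elim: k c => [|k IH] c; split; try by move=> x _; exact: cst_continuous.
  by [].
move=> i; split; first by move=> x _; exact: derivable_cst.
rewrite (_ : partial i (cst c) = cst 0); first exact: IH.
by apply/funext => x; exact: derive_cst.
Qed.

(** The zero field is a competitor. The sign allows [K <= L] to be multiplied by the variation of
    [u0]. *)
Lemma tvM_ge0 (u : Borel M -> R) : (0 <= tvM g vol u)%E.
Proof.
apply: ereal_sup_ubound; exists (fun _ _ => 0) => /=; last first.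
  apply: integral0_eq => x _; rewrite /div_g /= big1 ?mulr0 ?mulr0// => i _.
  rewrite /partial (_ : (fun z => _) = cst (0 : R^o)); first exact: derive_cst.
  by apply/funext => z; rewrite mxE mulr0.
split; last by move=> x; rewrite /vnorm mul0mx mul0mx mxE sqrtr0.
split => [a i|a b y _]; last by rewrite mul0mx.
rewrite (_ : (fun y => _) = cst 0); first exact: Ck_on_cst.
by apply/funext => y; rewrite mxE.
Qed.

End total_variation_manifold.

Local Open Scope ereal_scope.

Theorem mainTheorem2 (R : realType) (n : nat) (M : ptopologicalType)
    (A : smooth_atlas R n M) (g : riemannian_metric A)
    (vol : {measure set (Borel M) -> \bar R}) (L B : R) (u0 : Borel M -> R) :
  (2 <= n)%N ->
  hausdorff_space M ->
  compact [set: M] ->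
  is_riemannian_volume g vol ->
  is_L1_entropy_constant n L ->
  is_sobolev_constant g vol B ->
  BVM g vol u0 ->
  L1norm vol u0 = 1 ->
  entropy vol u0 = n%:R%:E * lne (L%:E * tvM g vol u0 + B%:E) ->
  Lstarnorm vol n u0 = (K1 R n)%:E * tvM g vol u0 + B%:E * L1norm vol u0.
Proof.
move=> n2 _ _ _ [entL _] [sobB _] BVu u1 ent.
have [Iu tu] := BVu; have tv0 := tvM_ge0 g vol u0.
have KL : (K1 R n <= L)%R by apply: K1_le_entropy_constant.
have n0 : (0 < n)%N by exact: leq_trans n2.
have := sobB u0 BVu; rewrite u1 mule1.
have tvf : tvM g vol u0 \is a fin_num by rewrite ge0_fin_numE.
move: ent tv0; rewrite -(fineK tvf); set t := fine _; rewrite lee_fin -!EFinM -!EFinD => ent t0 sob.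
have N0 : 0 <= Lstarnorm vol n u0 by exact: Lnorm_ge0.
have Nf : Lstarnorm vol n u0 \is a fin_num.
  by rewrite ge0_fin_numE//; apply: le_lt_trans sob _; rewrite ltry.
move: sob N0; rewrite -(fineK Nf); set N := fine _; rewrite !lee_fin => sob N0.
congr EFin; apply/eqP; rewrite eq_le sob /=.
apply: (@le_trans _ _ (L * t + B)%R); first by rewrite lerD2r ler_wpM2r.
(* Where [lne] takes the value -oo, the bound follows instead from the nonnegativity of the norm
   [N]. *)
have [LB|LB] := leP (L * t + B)%R 0%R; first exact: le_trans N0.
(* A zero norm would make [u0] vanish almost everywhere, against its L^1 norm being 1; so the
   logarithm of [N] may be taken in Jensen's inequality. *)
have Np : (0 < N)%R.
  rewrite lt_neqAle N0 andbT; apply/eqP => N00.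
  have mu_ : measurable_fun setT (EFin \o u0) by case/integrableP: Iu.
  have p0 : (0 : \bar R) < (n%:R / (n%:R - 1) : R)%:E by rewrite lte_fin pstar_gt0.
  have : Lstarnorm vol n u0 = 0 by rewrite -(fineK Nf) -/N -N00.
  move=> /(Lnorm_eq0_eq0 mu_ p0) u00.
  move: u1; rewrite /L1norm Lnorm1 (_ : \int[vol]_x _ = 0).
    by move=> /eqP; rewrite eq_sym onee_eq0.
  transitivity (\int[vol]_x (cst 0 x : \bar R)); last by rewrite integral_cst// mul0e.
  apply: ae_eq_integral => //.
  - exact: measurableT_comp.
  - by apply: filterS u00 => x /= u0x _; have [E] := u0x I; rewrite E normr0.
have := entropy_le_Lstar n2 Iu u1 Np (esym (fineK Nf)).
rewrite ent lne_EFin// -EFinM lee_fin ler_pM2l ?ltr0n//.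
by rewrite ler_ln ?posrE.
Qed.
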